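(* Let $\mathcal M=(M,d,(q_i)_{i\in\mathbb N})$ be a computable metric space that is perfect (has no isolated points). Then for every special point $p$ and every rational $\delta>0$ there is a noncomputable $K$-trivial point $x\in M$ with $d(p,x)<\delta$.
   Context: A computable metric space is a complete separable metric space $(M,d)$ with a dense sequence $(q_i)$ without repetitions (the special points, identified with their indices $i\in\mathbb N$) such that $d(q_i,q_k)$ is a computable real uniformly in $i,k$. A Cauchy name is a function $\alpha:\mathbb N\to\mathbb N$ with $d(q_{\alpha(s)},q_{\alpha(t)})\le 2^{-s}$ for all $t\ge s$; it names $\lim_s q_{\alpha(s)}$. A point is computable if it has a computable Cauchy name. With $K$ prefix-free complexity (applied to tuples via a fixed effective encoding), a function $\alpha:\mathbb N\to\mathbb N$ is $K$-trivial if there is $b$ with $K(\alpha\upharpoonright n)\le K(0^n)+b$ for all $n$; a point is $K$-trivial if it has a $K$-trivial Cauchy name. *)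

(* Defs.v *)
From Stdlib Require Import Reals Lra Lia Arith List QArith.
Import ListNotations.
Open Scope R_scope.

Inductive rf : Type :=
| RZero : rf
| RSucc : rf
| RProj : nat -> rf
| RComp : rf -> list rf -> rf
| RRec  : rf -> rf -> rf
| RMu   : rf -> rf.

Inductive eval : rf -> list nat -> nat -> Prop :=
| ev_zero : forall v, eval RZero v 0
| ev_succ : forall x v, eval RSucc (x :: v) (S x)
| ev_proj : forall i v, eval (RProj i) v (nth i v 0%nat)
| ev_comp : forall f gs v ws y,
    eval_list gs v ws -> eval f ws y -> eval (RComp f gs) v y
| ev_rec0 : forall f g v y, eval f v y -> eval (RRec f g) (0%nat :: v) y
| ev_recS : forall f g n v z y,
    eval (RRec f g) (n :: v) z -> eval g (n :: z :: v) y ->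
    eval (RRec f g) (S n :: v) y
| ev_mu : forall f v n,
    eval f (n :: v) 0%nat ->
    (forall m, (m < n)%nat -> exists k, eval f (m :: v) (S k)) ->
    eval (RMu f) v n
with eval_list : list rf -> list nat -> list nat -> Prop :=
| evl_nil : forall v, eval_list [] v []
| evl_cons : forall g gs v w ws,
    eval g v w -> eval_list gs v ws -> eval_list (g :: gs) v (w :: ws).

Definition computable_fun (a : nat -> nat) : Prop :=
  exists e : rf, forall x, eval e [x] (a x).

Definition cpair (x y : nat) : nat := ((x + y) * (x + y + 1)) / 2 + y.

Fixpoint code_list (l : list nat) : nat :=
  match l with
  | [] => 0%nat
  | x :: l' => S (cpair x (code_list l'))
  end.

(* Bijective encoding of binary strings as naturals. *)
Fixpoint bcode (s : list bool) : nat :=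
  match s with
  | [] => 0%nat
  | b :: s' => (2 * bcode s' + (if b then 2 else 1))%nat
  end.

Definition run (e : rf) (tau : list bool) (y : nat) : Prop := eval e [bcode tau] y.

Definition is_prefix (s t : list bool) : Prop := exists u, t = s ++ u.

Definition prefix_free (e : rf) : Prop :=
  forall s t y z, run e s y -> run e t z -> is_prefix s t -> s = t.

(* [Kle e x k] : K_e(x) <= k, i.e. some e-description of x has length <= k. *)
Definition Kle (e : rf) (x : nat) (k : nat) : Prop :=
  exists tau, run e tau x /\ (length tau <= k)%nat.

Definition optimal_pf (U : rf) : Prop :=
  prefix_free U /\
  forall M : rf, prefix_free M ->
    exists c : nat, forall x k, Kle M x k -> Kle U x (k + c).

(* K_U(x) <= K_U(y) + b, as an inequality between the two minima. *)
Definition K_le_plus (U : rf) (x y b : nat) : Prop :=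
  forall k, Kle U y k -> Kle U x (k + b).

Definition restr (a : nat -> nat) (n : nat) : list nat := map a (seq 0 n).

Definition K_trivial_fun (U : rf) (a : nat -> nat) : Prop :=
  exists b : nat, forall n : nat,
    K_le_plus U (code_list (restr a n)) (code_list (repeat 0%nat n)) b.

Record CMS : Type := {
  cms_M :> Type;
  cms_d : cms_M -> cms_M -> R;
  cms_d_nonneg : forall x y, 0 <= cms_d x y;
  cms_d_zero : forall x y, cms_d x y = 0 <-> x = y;
  cms_d_sym : forall x y, cms_d x y = cms_d y x;
  cms_d_tri : forall x y z, cms_d x z <= cms_d x y + cms_d y z;
  cms_complete : forall s : nat -> cms_M,
    (forall eps, eps > 0 -> exists N, forall m n, (m >= N)%nat -> (n >= N)%nat ->
        cms_d (s m) (s n) < eps) ->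
    exists x, forall eps, eps > 0 -> exists N, forall n, (n >= N)%nat ->
        cms_d (s n) x < eps;
  cms_q : nat -> cms_M;
  cms_q_inj : forall i k, cms_q i = cms_q k -> i = k;
  cms_q_dense : forall x eps, eps > 0 -> exists i, cms_d x (cms_q i) < eps;
  cms_d_computable : exists e : rf, forall i k n, exists m,
    eval e [i; k; n] m /\
    Rabs (INR m / 2 ^ n - cms_d (cms_q i) (cms_q k)) <= / 2 ^ n
}.

Arguments cms_d {c} _ _.
Arguments cms_q {c} _.

Definition perfect (X : CMS) : Prop :=
  forall (x : X) eps, eps > 0 -> exists y : X, y <> x /\ cms_d x y < eps.

Definition cauchy_name (X : CMS) (a : nat -> nat) : Prop :=
  forall s t, (s <= t)%nat -> cms_d (cms_q (c:=X) (a s)) (cms_q (a t)) <= (/ 2) ^ s.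

Definition names (X : CMS) (a : nat -> nat) (x : X) : Prop :=
  cauchy_name X a /\
  forall eps, eps > 0 -> exists N, forall n, (n >= N)%nat ->
    cms_d (cms_q (c:=X) (a n)) x < eps.

Definition computable_point (X : CMS) (x : X) : Prop :=
  exists a, names X a x /\ computable_fun a.

Definition K_trivial_point (X : CMS) (U : rf) (x : X) : Prop :=
  exists a, names X a x /\ K_trivial_fun U a.

(* Main.v *)
Require Import Defs.
From Stdlib Require Import Reals QArith Qreals Arith Lia Lra List Bool ClassicalEpsilon.
Import ListNotations.
Open Scope nat_scope.

(** A K-trivial noncomputable set [A] is enumerated by the cost function method:
    requirement [e] waits for a number [n = <e, i>] on which the [e]-th function
    is seen to take the value 0 while the descriptions of the strings [0^k],
    [k > n], found so far by [U] weigh at most [2 ^ - e], and then puts [n] into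
    [A].  There are no injuries, as every requirement has its own column.  When
    [e] acts, the affected descriptions form a finite prefix-free set of weight
    at most [2 ^ - e]; its Kraft code, computed at once, gives them new
    codewords that are [e] bits shorter, which pays for the self-delimiting tag
    naming [e].  No online Kraft-Chaitin allocation is needed.

    In a perfect space, [A] is then read as a path through a computable tree of
    special points with shrinking balls.  The path is a Cauchy name whose first
    [k] terms depend on [k] bits of [A] only, hence is K-trivial, and [A] can be
    recovered from any name of its limit. *)

(** * Closure properties of the total recursive functions *)

(** Losses do not accumulate, however many requirements act below [k]: every new codeword is
    computed from a description by [U] itself, never from an earlier codeword. If [t] describes
    [0^k], only the last action below [k] after [t] is found to halt matters, and its codeword has
    length [|t| + 2]: it drops [e] bits and pays [e + 2] for the tag. Hence one constant serves all
    [k]. The cost bound cannot block a requirement forever, because the domain of [U] has finite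
    weight, so that large numbers of a column are cheap at every stage. Weights are scaled by powers
    of two, which keeps the construction within arithmetic on natural numbers. Acting once per
    requirement is also what keeps the decoding machine prefix-free: the Kraft codes of two stages
    under the same tag could overlap. *)

(* Total functions of [k] variables are handled as functionals of an
   environment [rho : nat -> nat], of which only the first [k] values are
   passed to the program; shifting the environment under a binder is then
   absorbed by beta reduction. *)
Definition recfun (k : nat) (F : (nat -> nat) -> nat) : Prop :=
  exists e, forall rho, eval e (map rho (seq 0 k)) (F rho).

Definition rec1 (f : nat -> nat) := recfun 1 (fun r => f (r 0)).
Definition rec2 (f : nat -> nat -> nat) := recfun 2 (fun r => f (r 0) (r 1)).
Definition rec3 (f : nat -> nat -> nat -> nat) :=
  recfun 3 (fun r => f (r 0) (r 1) (r 2)).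

Definition scons (x : nat) (rho : nat -> nat) (i : nat) : nat :=
  match i with 0 => x | S i => rho i end.

Lemma map_scons x rho k :
  map (scons x rho) (seq 0 (S k)) = x :: map rho (seq 0 k).
Proof.
  simpl. f_equal. rewrite <- seq_shift, map_map. reflexivity.
Qed.

Lemma recfun_ext k F G : (forall r, F r = G r) -> recfun k F -> recfun k G.
Proof. intros H [e He]. exists e. intro r. rewrite <- H. apply He. Qed.

Lemma recfun_var k i : i < k -> recfun k (fun r => r i).
Proof.
  intro H. exists (RProj i). intro r.
  replace (r i) with (nth i (map r (seq 0 k)) 0); [constructor|].
  rewrite nth_indep with (d' := r 0) by (rewrite length_map, length_seq; lia).
  rewrite map_nth, seq_nth; auto.
Qed.

Lemma recfun_succ k F : recfun k F -> recfun k (fun r => S (F r)).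
Proof.
  intros [e He]. exists (RComp RSucc [e]). intro r.
  econstructor; [repeat constructor; apply He | constructor].
Qed.

Lemma recfun_const k c : recfun k (fun _ => c).
Proof.
  induction c.
  - exists RZero. constructor.
  - now apply (recfun_succ k (fun _ => c)).
Qed.

Lemma recfun_comp k Gs F :
  Forall (recfun k) Gs -> recfun (length Gs) F ->
  recfun k (fun r => F (fun i => nth i (map (fun G => G r) Gs) 0)).
Proof.
  intros HGs [e He].
  assert (H : exists es, forall r, eval_list es (map r (seq 0 k)) (map (fun G => G r) Gs)).
  { clear F e He. induction HGs as [|G Gs [e He] _ [es IH]].
    - exists []. constructor.
    - exists (e :: es). intro r. constructor; auto. }
  destruct H as [es Hes]. exists (RComp e es). intro r.
  econstructor; [apply Hes|].
  replace (map (fun G => G r) Gs) with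
    (map (fun i => nth i (map (fun G => G r) Gs) 0) (seq 0 (length Gs))) at 1; [apply He|].
  apply nth_ext with 0 0; rewrite !length_map, length_seq; auto.
  intros n Hn.
  rewrite nth_indep with (d' := nth 0 (map (fun G => G r) Gs) 0)
    by (now rewrite length_map, length_seq).
  rewrite (map_nth (fun i => nth i (map (fun G => G r) Gs) 0)).
  now rewrite seq_nth.
Qed.

Lemma recfun_app1 f k A : rec1 f -> recfun k A -> recfun k (fun r => f (A r)).
Proof. intros Hf HA. apply (recfun_comp k [A] _ ltac:(auto) Hf). Qed.

Lemma recfun_app2 f k A B : rec2 f -> recfun k A -> recfun k B ->
  recfun k (fun r => f (A r) (B r)).
Proof. intros Hf HA HB. apply (recfun_comp k [A; B] _ ltac:(auto) Hf). Qed.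

Lemma recfun_app3 f k A B C : rec3 f -> recfun k A -> recfun k B -> recfun k C ->
  recfun k (fun r => f (A r) (B r) (C r)).
Proof. intros Hf HA HB HC. apply (recfun_comp k [A; B; C] _ ltac:(auto) Hf). Qed.

Lemma eval_projs k v :
  forall m, k + m = length v ->
  eval_list (map RProj (seq k m)) v (skipn k v).
Proof.
  intro m; revert k. induction m as [|m IH]; intros k H; simpl.
  - rewrite skipn_all2 by lia. constructor.
  - assert (Hk : skipn k v = nth k v 0 :: skipn (S k) v).
    { clear IH. assert (Hl : k < length v) by lia. clear H. revert k Hl.
      induction v as [|a v IHv]; intros k Hl; simpl in *; [lia|].
      destruct k; auto. apply IHv. lia. }
    rewrite Hk. constructor; [constructor|]. apply IH. lia.
Qed.

Lemma recfun_rec k (N A : (nat -> nat) -> nat) (B : (nat -> nat) -> nat -> nat -> nat) :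
  recfun k A ->
  recfun (S (S k)) (fun r => B (fun i => r (S (S i))) (r 0) (r 1)) ->
  recfun k N ->
  recfun k (fun r => nat_rect (fun _ => nat) (A r) (fun n z => B r n z) (N r)).
Proof.
  intros [ea Ha] [eb Hb] [en Hn].
  exists (RComp (RRec ea eb) (en :: map RProj (seq 0 k))). intro r.
  econstructor.
  - constructor; [apply Hn|].
    apply (eval_projs 0); now rewrite length_map, length_seq.
  - simpl skipn. generalize (N r) as n. induction n as [|n IH]; simpl.
    + constructor. apply Ha.
    + econstructor; [apply IH|].
      specialize (Hb (scons n (scons (nat_rect (fun _ => nat) (A r) (fun n z => B r n z) n) r))).
      rewrite !map_scons in Hb. exact Hb.
Qed.

Ltac rec_step :=
  lazymatch goal with
  | |- recfun _ (fun r => r ?i) => apply recfun_var; lia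
  | |- recfun _ (fun _ => ?c) => apply recfun_const
  | |- recfun _ (fun r => S (@?F r)) => apply (recfun_succ _ F)
  | |- recfun _ (fun r => nat_rect _ (@?A r) (fun n z => @?B r n z) (@?N r)) =>
      apply (recfun_rec _ N A B); cbv beta
  | |- recfun _ (fun r => ?f (@?A r) (@?B r) (@?C r)) =>
      apply (recfun_app3 f _ A B C); [solve [auto with recdb] | ..]
  | |- recfun _ (fun r => ?f (@?A r) (@?B r)) =>
      apply (recfun_app2 f _ A B); [solve [auto with recdb] | ..]
  | |- recfun _ (fun r => ?f (@?A r)) =>
      apply (recfun_app1 f _ A); [solve [auto with recdb] | ..]
  end.
Ltac rec_auto := try unfold rec1, rec2, rec3; cbv beta; repeat (rec_step; cbv beta).
Create HintDb recdb.

Lemma rec2_add : rec2 Nat.add.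
Proof.
  apply (recfun_ext _ (fun r => nat_rect (fun _ => nat) (r 1) (fun n z => S z) (r 0))); [|rec_auto].
  intro r. induction (r 0); simpl; auto.
Qed.
#[export] Hint Resolve rec2_add : recdb.

Lemma rec1_pred : rec1 Nat.pred.
Proof.
  apply (recfun_ext _ (fun r => nat_rect (fun _ => nat) 0 (fun n z => n) (r 0))); [|rec_auto].
  intro r. destruct (r 0); simpl; auto.
Qed.
#[export] Hint Resolve rec1_pred : recdb.

Lemma rec2_sub : rec2 Nat.sub.
Proof.
  apply (recfun_ext _ (fun r => nat_rect (fun _ => nat) (r 0) (fun n z => Nat.pred z) (r 1))); [|rec_auto].
  intro r. induction (r 1) as [|n IH]; cbn [nat_rect]; [|rewrite IH]; lia.
Qed.
#[export] Hint Resolve rec2_sub : recdb.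

Lemma rec2_mul : rec2 Nat.mul.
Proof.
  apply (recfun_ext _ (fun r => nat_rect (fun _ => nat) 0 (fun n z => r 1 + z) (r 0))); [|rec_auto].
  intro r. induction (r 0); simpl; auto.
Qed.
#[export] Hint Resolve rec2_mul : recdb.

Lemma rec2_pow : rec2 Nat.pow.
Proof.
  apply (recfun_ext _ (fun r => nat_rect (fun _ => nat) 1 (fun n z => r 0 * z) (r 1))); [|rec_auto].
  intro r. induction (r 1); simpl; auto.
Qed.
#[export] Hint Resolve rec2_pow : recdb.

(* Boolean tests are passed around as 0/1-valued functions through [Nat.b2n]. *)
Lemma recfun_if k (P : (nat -> nat) -> bool) A B :
  recfun k (fun r => Nat.b2n (P r)) -> recfun k A -> recfun k B ->
  recfun k (fun r => if P r then A r else B r).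
Proof.
  intros HP HA HB.
  apply (recfun_ext _ (fun r => Nat.b2n (P r) * A r + (1 - Nat.b2n (P r)) * B r)); [|rec_auto; auto].
  intro r; cbv beta. destruct (P r); simpl; lia.
Qed.

Lemma recfun_leb k A B : recfun k A -> recfun k B ->
  recfun k (fun r => Nat.b2n (A r <=? B r)).
Proof.
  intros HA HB. apply (recfun_ext _ (fun r => 1 - (A r - B r))); [|rec_auto; auto].
  intro r; cbv beta. destruct (Nat.leb_spec (A r) (B r)); cbn [Nat.b2n]; lia.
Qed.

Lemma recfun_ltb k A B : recfun k A -> recfun k B ->
  recfun k (fun r => Nat.b2n (A r <? B r)).
Proof.
  intros HA HB. apply (recfun_leb k (fun r => S (A r)) B); rec_auto; auto.
Qed.

Lemma recfun_eqb k A B : recfun k A -> recfun k B ->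
  recfun k (fun r => Nat.b2n (A r =? B r)).
Proof.
  intros HA HB. apply (recfun_ext _ (fun r => 1 - ((A r - B r) + (B r - A r)))); [|rec_auto; auto].
  intro r; cbv beta. destruct (Nat.eqb_spec (A r) (B r)); cbn [Nat.b2n]; lia.
Qed.

Lemma recfun_andb k P Q : recfun k (fun r => Nat.b2n (P r)) -> recfun k (fun r => Nat.b2n (Q r)) ->
  recfun k (fun r => Nat.b2n (P r && Q r)).
Proof.
  intros HA HB. apply (recfun_ext _ (fun r => Nat.b2n (P r) * Nat.b2n (Q r))); [|rec_auto; auto].
  intro r; cbv beta. destruct (P r), (Q r); reflexivity.
Qed.

(** * Bounded sums, which also serve as bounded quantifiers *)

Definition bsum (n : nat) (f : nat -> nat) : nat :=
  nat_rect (fun _ => nat) 0 (fun i z => z + f i) n.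

Lemma recfun_bsum k N (E : (nat -> nat) -> nat -> nat) :
  recfun (S k) (fun r => E (fun i => r (S i)) (r 0)) -> recfun k N ->
  recfun k (fun r => bsum (N r) (fun i => E r i)).
Proof.
  intros [e He] HN. unfold bsum.
  refine (recfun_rec k N (fun _ => 0) (fun r n z => z + E r n) _ _ HN); rec_auto.
  (* Position 1 of the argument list holds the accumulator, which the summand does not see; the
     projections skip it. *)
  exists (RComp e (RProj 0 :: map RProj (seq 2 k))). intro r.
  specialize (He (scons (r 0) (fun i => r (S (S i))))).
  rewrite map_scons in He. cbn [scons] in He.
  econstructor; [|exact He].
  constructor.
  - change (r 0) with (nth 0 (map r (seq 0 (S (S k)))) 0). constructor.
  - replace (map (fun i => r (S (S i))) (seq 0 k)) with (skipn 2 (map r (seq 0 (S (S k))))).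
    + apply eval_projs. rewrite length_map, length_seq. lia.
    + simpl. rewrite <- !seq_shift, !map_map. reflexivity.
Qed.

Ltac rec_step_test :=
  lazymatch goal with
  | |- recfun _ (fun r => Nat.b2n (Nat.leb (@?A r) (@?B r))) => apply (recfun_leb _ A B)
  | |- recfun _ (fun r => Nat.b2n (Nat.ltb (@?A r) (@?B r))) => apply (recfun_ltb _ A B)
  | |- recfun _ (fun r => Nat.b2n (Nat.eqb (@?A r) (@?B r))) => apply (recfun_eqb _ A B)
  | |- recfun _ (fun r => Nat.b2n (andb (@?A r) (@?B r))) => apply (recfun_andb _ A B)
  | |- recfun _ (fun r => if @?P r then @?A r else @?B r) => apply (recfun_if _ P A B)
  | |- recfun _ (fun r => bsum (@?N r) (fun i => @?E r i)) => apply (recfun_bsum _ N E)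
  | |- _ => rec_step
  end.
Ltac rec_auto ::= try unfold rec1, rec2, rec3; cbv beta; repeat (rec_step_test; cbv beta).

Lemma bsum_S n f : bsum (S n) f = bsum n f + f n.
Proof. reflexivity. Qed.

Lemma bsum_ext n f g : (forall i, i < n -> f i = g i) -> bsum n f = bsum n g.
Proof.
  induction n as [|n IH]; intro H; auto.
  rewrite !bsum_S, IH, H; auto.
Qed.

Lemma bsum_le n f g : (forall i, i < n -> f i <= g i) -> bsum n f <= bsum n g.
Proof.
  induction n as [|n IH]; intro H; auto.
  rewrite !bsum_S. apply Nat.add_le_mono; auto.
Qed.

Lemma bsum_mul n f c : bsum n f * c = bsum n (fun i => f i * c).
Proof.
  induction n as [|n IH]; auto. rewrite !bsum_S, <- IH. lia.
Qed.

Lemma bsum_plus n f g : bsum n f + bsum n g = bsum n (fun i => f i + g i).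
Proof.
  induction n as [|n IH]; auto. rewrite !bsum_S, <- IH. lia.
Qed.

Lemma bsum_extend m n f : m <= n -> (forall i, m <= i -> i < n -> f i = 0) ->
  bsum n f = bsum m f.
Proof.
  induction 1 as [|n Hmn IH]; intro H; auto.
  rewrite bsum_S, IH, H; auto.
Qed.

Lemma bsum_mono_n m n f : m <= n -> bsum m f <= bsum n f.
Proof. induction 1; auto. rewrite bsum_S; lia. Qed.

Lemma bsum_term n f i : i < n -> f i <= bsum n f.
Proof.
  intro H. transitivity (bsum (S i) f); [rewrite bsum_S; lia | now apply bsum_mono_n].
Qed.

Lemma bsum_pos n f : 0 < bsum n f <-> exists i, i < n /\ 0 < f i.
Proof.
  split.
  - induction n as [|n IH]; [cbn; lia|].
    rewrite bsum_S. intro H.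
    destruct (Nat.eq_dec (f n) 0).
    + destruct IH as (i & Hi & Hf); [lia|]. exists i; split; auto.
    + exists n; split; lia.
  - intros (i & Hi & Hf). pose proof (bsum_term n f i Hi). lia.
Qed.

Lemma bsum_zero n f : bsum n f = 0 <-> forall i, i < n -> f i = 0.
Proof.
  split.
  - intros H i Hi. pose proof (bsum_term n f i Hi). lia.
  - intro H. rewrite (bsum_ext n f (fun _ => 0)) by auto. induction n; auto.
    rewrite bsum_S, IHn; auto.
Qed.

(** Replaces bounded search: the threshold of a downward closed test is the number of its successes.
    Quotients, triangular roots, binary lengths and [zlen] are all computed in this way. *)
Lemma bsum_count n W f : (forall i, i < n -> f i = Nat.b2n (i <? W)) ->
  bsum n f = Nat.min n W.
Proof.
  induction n as [|n IH]; intro H; auto.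
  rewrite bsum_S, IH, H by auto.
  destruct (Nat.ltb_spec n W); simpl Nat.b2n; lia.
Qed.

Lemma rec2_div : rec2 Nat.div.
Proof.
  apply (recfun_ext _ (fun r => if r 1 =? 0 then 0 else
     bsum (r 0) (fun k => Nat.b2n (S k * r 1 <=? r 0)))); [|rec_auto].
  intro r; cbv beta. destruct (Nat.eqb_spec (r 1) 0) as [->|H0]; [reflexivity|].
  rewrite bsum_count with (W := r 0 / r 1).
  - apply Nat.min_r. apply Nat.Div0.div_le_upper_bound. nia.
  - intros i Hi. f_equal.
    pose proof (Nat.div_mod (r 0) (r 1) H0). pose proof (Nat.mod_upper_bound (r 0) (r 1) H0).
    destruct (Nat.leb_spec (S i * r 1) (r 0)), (Nat.ltb_spec i (r 0 / r 1)); auto; nia.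
Qed.
#[export] Hint Resolve rec2_div : recdb.

Lemma rec2_mod : rec2 Nat.modulo.
Proof.
  apply (recfun_ext _ (fun r => r 0 - r 1 * (r 0 / r 1))); [|rec_auto].
  intro r. symmetry. apply Nat.Div0.mod_eq.
Qed.
#[export] Hint Resolve rec2_mod : recdb.

(** * Inverses of the Cantor pairing *)

Definition tri (w : nat) := w * (w + 1) / 2.

Lemma tri_S w : tri (S w) = tri w + S w.
Proof.
  unfold tri. replace (S w * (S w + 1)) with (w * (w + 1) + S w * 2) by lia.
  now rewrite Nat.div_add.
Qed.

Lemma tri_mono a b : a <= b -> tri a <= tri b.
Proof. induction 1; auto. rewrite tri_S. lia. Qed.

Lemma tri_ge w : w <= tri w.
Proof. destruct w; [cbn; lia|]. rewrite tri_S. lia. Qed.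

Lemma cpair_tri x y : cpair x y = tri (x + y) + y.
Proof. reflexivity. Qed.

(** The triangular root: the index [x + y] of the diagonal on which [n = cpair x y] lies. *)
Definition troot (n : nat) := bsum n (fun k => Nat.b2n (tri (S k) <=? n)).
Definition p2 (n : nat) := n - tri (troot n).
Definition p1 (n : nat) := troot n - p2 n.

Lemma troot_cpair x y : troot (cpair x y) = x + y.
Proof.
  rewrite cpair_tri. unfold troot.
  rewrite bsum_count with (W := x + y).
  - apply Nat.min_r. pose proof (tri_ge (x + y)). lia.
  - intros i _. f_equal.
    destruct (Nat.leb_spec (tri (S i)) (tri (x + y) + y)), (Nat.ltb_spec i (x + y)); auto.
    + pose proof (tri_mono (S (x + y)) (S i) ltac:(lia)). rewrite (tri_S (x + y)) in *. lia.
    + pose proof (tri_mono (S i) (x + y) ltac:(lia)). lia.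
Qed.

Lemma p2_cpair x y : p2 (cpair x y) = y.
Proof. unfold p2. rewrite troot_cpair, cpair_tri. lia. Qed.

Lemma p1_cpair x y : p1 (cpair x y) = x.
Proof. unfold p1. rewrite troot_cpair, p2_cpair. lia. Qed.

Lemma cpair_ge_r x y : y <= cpair x y.
Proof. rewrite cpair_tri. lia. Qed.

Lemma rec2_cpair : rec2 cpair.
Proof. unfold cpair. rec_auto. Qed.
Lemma rec1_tri : rec1 tri.
Proof. unfold tri. rec_auto. Qed.
#[export] Hint Resolve rec2_cpair rec1_tri : recdb.
Lemma rec1_troot : rec1 troot.
Proof. unfold troot. rec_auto. Qed.
#[export] Hint Resolve rec1_troot : recdb.
Lemma rec1_p2 : rec1 p2.
Proof. unfold p2. rec_auto. Qed.
#[export] Hint Resolve rec1_p2 : recdb.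
Lemma rec1_p1 : rec1 p1.
Proof. unfold p1. rec_auto. Qed.
#[export] Hint Resolve rec1_p1 : recdb.

(** * A universal step-bounded interpreter *)

(** An explicit stack lets a step inspect only the top of a configuration, so that it becomes a
    simple function on codes. *)
Inductive frame : Type :=
| FArg : rf -> list rf -> list nat -> list nat -> frame
| FRec : rf -> nat -> list nat -> frame
| FMu : rf -> nat -> list nat -> frame.

(* In [CArgs f rgs v ws k] and [FArg f rgs v ws] the list [rgs] holds the
   arguments still to be evaluated, last one first, so that consing their
   values onto [ws] yields the argument list of [f] in the right order. *)
Inductive config : Type :=
| CEval : rf -> list nat -> list frame -> config
| CArgs : rf -> list rf -> list nat -> list nat -> list frame -> config
| CRet : nat -> list frame -> config.

(** Where [eval] has no rule, as for [RSucc] and [RRec] on an empty argument list, the configuration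
    loops on itself and thus never halts. *)
Definition step (c : config) : config :=
  match c with
  | CEval RZero v k => CRet 0 k
  | CEval RSucc [] k => c
  | CEval RSucc (x :: v) k => CRet (S x) k
  | CEval (RProj i) v k => CRet (nth i v 0) k
  | CEval (RComp f gs) v k => CArgs f (rev gs) v [] k
  | CEval (RRec f g) [] k => c
  | CEval (RRec f g) (0 :: v) k => CEval f v k
  | CEval (RRec f g) (S n :: v) k => CEval (RRec f g) (n :: v) (FRec g n v :: k)
  | CEval (RMu f) v k => CEval f (0 :: v) (FMu f 0 v :: k)
  | CArgs f [] v ws k => CEval f ws k
  | CArgs f (g :: rgs) v ws k => CEval g v (FArg f rgs v ws :: k)
  | CRet _ [] => c
  | CRet w (FArg f rgs v ws :: k) => CArgs f rgs v (w :: ws) k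
  | CRet w (FRec g n v :: k) => CEval g (n :: w :: v) k
  | CRet w (FMu f n v :: k) =>
      match w with
      | 0 => CRet n k
      | S _ => CEval f (S n :: v) (FMu f (S n) v :: k)
      end
  end.

Definition reach (c d : config) := exists n, Nat.iter n step c = d.

Lemma reach_refl c : reach c c.
Proof. now exists 0. Qed.

Lemma reach_trans c d e : reach c d -> reach d e -> reach c e.
Proof.
  intros [n Hn] [m Hm]. exists (m + n). now rewrite Nat.iter_add, Hn.
Qed.

Lemma reach_step c d : reach (step c) d -> reach c d.
Proof. apply reach_trans. now exists 1. Qed.

(* A fixpoint on derivations: the generated induction scheme gives no
   hypothesis for the derivations under the [exists] of [ev_mu]. *)
Fixpoint eval_reach e v y (H : eval e v y) {struct H} :
  forall k, reach (CEval e v k) (CRet y k)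
with eval_list_reach gs v ws (H : eval_list gs v ws) {struct H} :
  forall f rgs ws0 k,
    reach (CArgs f (rev gs ++ rgs) v ws0 k) (CArgs f rgs v (ws ++ ws0) k).
Proof.
  - destruct H as [v|x v|i v|f gs v ws y Hgs Hf|f g v y Hf|f g n v z y Hz Hy|f v n H0 Hm];
      intro k; apply reach_step; cbn.
    + apply reach_refl.
    + apply reach_refl.
    + apply reach_refl.
    + pose proof (eval_list_reach gs v ws Hgs f [] [] k) as IH.
      rewrite !app_nil_r in IH.
      eapply reach_trans; [exact IH|]. apply reach_step; cbn.
      apply (eval_reach _ _ _ Hf).
    + apply (eval_reach _ _ _ Hf).
    + eapply reach_trans; [apply (eval_reach _ _ _ Hz)|].
      apply reach_step; cbn. apply (eval_reach _ _ _ Hy).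
    + assert (Hi : forall i, i <= n ->
              reach (CEval f (0 :: v) (FMu f 0 v :: k)) (CEval f (i :: v) (FMu f i v :: k))).
      { induction i as [|i IHi]; intro Hi; [apply reach_refl|].
        eapply reach_trans; [apply IHi; lia|].
        destruct (Hm i Hi) as [z Hz].
        eapply reach_trans; [apply (eval_reach _ _ _ Hz)|].
        apply reach_step; cbn. apply reach_refl. }
      eapply reach_trans; [apply (Hi n (Nat.le_refl n))|].
      eapply reach_trans; [apply (eval_reach _ _ _ H0)|].
      apply reach_step; cbn. apply reach_refl.
  - destruct H as [v|g gs v w ws Hg Hgs]; intros f rgs ws0 k; cbn.
    + apply reach_refl.
    + rewrite <- app_assoc. eapply reach_trans; [apply (eval_list_reach _ _ _ Hgs)|].
      apply reach_step; cbn. eapply reach_trans; [apply (eval_reach _ _ _ Hg)|].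
      apply reach_step; cbn. apply reach_refl.
Qed.

Lemma iter_halted y n : Nat.iter n step (CRet y []) = CRet y [].
Proof. induction n as [|n IH]; simpl; [|rewrite IH]; reflexivity. Qed.

Lemma halted_persists c y n m : n <= m ->
  Nat.iter n step c = CRet y [] -> Nat.iter m step c = CRet y [].
Proof.
  intros Hnm H. replace m with ((m - n) + n) by lia.
  now rewrite Nat.iter_add, H, iter_halted.
Qed.

(** The machine is a function and halted configurations are fixed points, so no induction over two
    derivations is needed. *)
Lemma eval_det e v y z : eval e v y -> eval e v z -> y = z.
Proof.
  intros Hy Hz.
  destruct (eval_reach e v y Hy []) as [n Hn], (eval_reach e v z Hz []) as [m Hm].
  apply (halted_persists _ _ n (n + m) ltac:(lia)) in Hn.
  apply (halted_persists _ _ m (n + m) ltac:(lia)) in Hm.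
  congruence.
Qed.

Definition mu_from f n v r : Prop :=
  eval f (r :: v) 0 /\ n <= r /\
  forall m, n <= m < r -> exists k, eval f (m :: v) (S k).

Definition frame_result (fr : frame) (w r : nat) : Prop :=
  match fr with
  | FArg f rgs v ws => exists ws', eval_list (rev rgs) v ws' /\ eval f (ws' ++ w :: ws) r
  | FRec g n v => eval g (n :: w :: v) r
  | FMu f n v => match w with 0 => r = n | S _ => mu_from f (S n) v r end
  end.

Fixpoint stack_result (k : list frame) (w y : nat) : Prop :=
  match k with
  | [] => y = w
  | fr :: k' => exists r, frame_result fr w r /\ stack_result k' r y
  end.

(** The big-step meaning of a whole configuration, stack included. It is pulled back along single
    steps, which gives soundness of the machine without cutting a run into subcomputations. *)
Definition config_result (c : config) (y : nat) : Prop :=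
  match c with
  | CEval e v k => exists r, eval e v r /\ stack_result k r y
  | CArgs f rgs v ws k => exists ws' r,
      eval_list (rev rgs) v ws' /\ eval f (ws' ++ ws) r /\ stack_result k r y
  | CRet w k => stack_result k w y
  end.

Lemma eval_list_snoc gs g v ws w :
  eval_list gs v ws -> eval g v w -> eval_list (gs ++ [g]) v (ws ++ [w]).
Proof.
  revert ws. induction gs as [|g' gs IH]; intros ws H Hw; inversion H; subst; simpl.
  - repeat constructor. assumption.
  - constructor; auto.
Qed.

Lemma step_result c y : config_result (step c) y -> config_result c y.
Proof.
  destruct c as [e v k|f rgs v ws k|w k].
  - destruct e as [| |i|f gs|f g|f].
    + simpl. intro H. exists 0. split; [constructor | exact H].
    + destruct v as [|x v]; simpl; auto. intro H.
      exists (S x). split; [constructor | exact H].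
    + simpl. intro H. exists (nth i v 0). split; [constructor | exact H].
    + simpl. intros (ws' & r & H1 & H2 & H3). rewrite rev_involutive in H1.
      rewrite app_nil_r in H2. exists r. split; auto. econstructor; eauto.
    + destruct v as [|[|n] v]; simpl; auto.
      * intros (r & H1 & H2). exists r. split; auto. now constructor.
      * intros (z & H1 & r & H2 & H3). exists r. split; auto. econstructor; eauto.
    + simpl. intros (w & H1 & r & H2 & H3). exists r. split; auto.
      destruct w as [|w].
      * subst r. constructor; auto. lia.
      * destruct H2 as (H4 & _ & H5). constructor; auto.
        intros [|m] Hm; [now exists w|]. apply H5. lia.
  - destruct rgs as [|g rgs]; simpl.
    + intros (r & H1 & H2). exists [], r. repeat split; auto. constructor.
    + intros (w & H1 & r & (ws' & H2 & H3) & H4).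
      exists (ws' ++ [w]), r. rewrite <- app_assoc. repeat split; auto.
      now apply eval_list_snoc.
  - destruct k as [|[f rgs v ws|g n v|f n v] k]; simpl; auto.
    + intros (ws' & r & H1 & H2 & H3). exists r. split; auto. exists ws'. auto.
    + destruct w as [|w].
      * simpl. intro H. exists n. auto.
      * simpl. intros (z & H1 & r & H2 & H3). exists r. split; auto.
        destruct z as [|z].
        -- subst r. repeat split; auto. intros; lia.
        -- destruct H2 as (H4 & H5 & H6). repeat split; auto; [lia|].
           intros m Hm. destruct (Nat.eq_dec m (S n)) as [->|]; [now exists z|].
           apply H6. lia.
Qed.

Lemma iter_result n c y : config_result (Nat.iter n step c) y -> config_result c y.
Proof.
  induction n as [|n IH]; simpl; auto. intro H. apply IH, step_result, H.
Qed.

Lemma eval_iff_reach e v y : eval e v y <-> reach (CEval e v []) (CRet y []).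
Proof.
  split; [intro; now apply eval_reach|].
  intros [n Hn]. destruct (iter_result n (CEval e v []) y) as (r & Hr & Hy).
  - now rewrite Hn.
  - simpl in Hy. now subst.
Qed.

(** Arguments of [RComp] are coded last one first, in the order in which the machine evaluates them,
    so [nstep] never has to reverse a list. *)
Fixpoint rf_code (e : rf) : nat :=
  match e with
  | RZero => cpair 0 0
  | RSucc => cpair 1 0
  | RProj i => cpair 2 i
  | RComp f gs => cpair 3 (cpair (rf_code f) (code_list (rev (map rf_code gs))))
  | RRec f g => cpair 4 (cpair (rf_code f) (rf_code g))
  | RMu f => cpair 5 (rf_code f)
  end.

Definition code_arg f rgs v ws := cpair (cpair f rgs) (cpair v ws).

Definition frame_code (fr : frame) : nat :=
  match fr with
  | FArg f rgs v ws =>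
      cpair 0 (code_arg (rf_code f) (code_list (map rf_code rgs)) (code_list v) (code_list ws))
  | FRec g n v => cpair 1 (cpair (rf_code g) (cpair n (code_list v)))
  | FMu f n v => cpair 2 (cpair (rf_code f) (cpair n (code_list v)))
  end.

Definition ceval e v k := cpair 0 (cpair (cpair e v) k).
Definition cargs f rgs v ws k := cpair 1 (cpair (code_arg f rgs v ws) k).
Definition cret y k := cpair 2 (cpair y k).

Definition config_code (c : config) : nat :=
  match c with
  | CEval e v k => ceval (rf_code e) (code_list v) (code_list (map frame_code k))
  | CArgs f rgs v ws k =>
      cargs (rf_code f) (code_list (map rf_code rgs)) (code_list v) (code_list ws)
        (code_list (map frame_code k))
  | CRet y k => cret y (code_list (map frame_code k))
  end.

Definition ccons x l := S (cpair x l).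
Definition chd l := p1 (pred l).
Definition ctl l := p2 (pred l).
Definition cnth i l := chd (nat_rect (fun _ => nat) l (fun _ z => ctl z) i).

Definition step_eval (c e v k : nat) : nat :=
  if p1 e =? 0 then cret 0 k
  else if p1 e =? 1 then (if v =? 0 then c else cret (S (chd v)) k)
  else if p1 e =? 2 then cret (cnth (p2 e) v) k
  else if p1 e =? 3 then cargs (p1 (p2 e)) (p2 (p2 e)) v 0 k
  else if p1 e =? 4 then
    (if v =? 0 then c
     else if chd v =? 0 then ceval (p1 (p2 e)) (ctl v) k
     else ceval e (ccons (pred (chd v)) (ctl v))
            (ccons (cpair 1 (cpair (p2 (p2 e)) (cpair (pred (chd v)) (ctl v)))) k))
  else ceval (p2 e) (ccons 0 v) (ccons (cpair 2 (cpair (p2 e) (cpair 0 v))) k).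

Definition step_args (a k : nat) : nat :=
  let f := p1 (p1 a) in let rgs := p2 (p1 a) in
  let v := p1 (p2 a) in let ws := p2 (p2 a) in
  if rgs =? 0 then ceval f ws k
  else ceval (chd rgs) v (ccons (cpair 0 (code_arg f (ctl rgs) v ws)) k).

Definition step_ret (c w k : nat) : nat :=
  if k =? 0 then c else
  let a := p2 (chd k) in
  if p1 (chd k) =? 0 then
    cargs (p1 (p1 a)) (p2 (p1 a)) (p1 (p2 a)) (ccons w (p2 (p2 a))) (ctl k)
  else if p1 (chd k) =? 1 then
    ceval (p1 a) (ccons (p1 (p2 a)) (ccons w (p2 (p2 a)))) (ctl k)
  else if w =? 0 then cret (p1 (p2 a)) (ctl k)
  else ceval (p1 a) (ccons (S (p1 (p2 a))) (p2 (p2 a)))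
         (ccons (cpair 2 (cpair (p1 a) (cpair (S (p1 (p2 a))) (p2 (p2 a))))) (ctl k)).

Definition nstep (c : nat) : nat :=
  if p1 c =? 0 then step_eval c (p1 (p1 (p2 c))) (p2 (p1 (p2 c))) (p2 (p2 c))
  else if p1 c =? 1 then step_args (p1 (p2 c)) (p2 (p2 c))
  else step_ret c (p1 (p2 c)) (p2 (p2 c)).

Opaque cpair p1 p2.

Lemma chd_ccons x l : chd (S (cpair x l)) = x.
Proof. apply p1_cpair. Qed.
Lemma ctl_ccons x l : ctl (S (cpair x l)) = l.
Proof. apply p2_cpair. Qed.

Lemma cnth_code i v : cnth i (code_list v) = nth i v 0.
Proof.
  assert (Ht : forall i v, ctl (code_list (skipn i v)) = code_list (skipn (S i) v)).
  { clear i v. induction i as [|i IH]; intros [|x v]; try reflexivity.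
    - apply ctl_ccons.
    - apply IH. }
  assert (Hi : nat_rect (fun _ => nat) (code_list v) (fun _ z => ctl z) i
                 = code_list (skipn i v)).
  { clear -Ht. induction i as [|i IH]; auto. cbn [nat_rect]. now rewrite IH. }
  unfold cnth. rewrite Hi. clear Hi.
  revert v. induction i as [|i IH]; intros [|x v]; try reflexivity.
  - apply chd_ccons.
  - apply IH.
Qed.

Ltac decode := repeat (rewrite ?p1_cpair, ?p2_cpair, ?chd_ccons, ?ctl_ccons, ?cnth_code;
   cbn [Nat.eqb code_list map Nat.pred]).

Lemma nstep_ceval e v k : nstep (ceval e v k) = step_eval (ceval e v k) e v k.
Proof. unfold nstep, ceval. now decode. Qed.

Lemma nstep_cargs f rgs v ws k :
  nstep (cargs f rgs v ws k) = step_args (code_arg f rgs v ws) k.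
Proof. unfold nstep, cargs. now decode. Qed.

Lemma nstep_cret w k : nstep (cret w k) = step_ret (cret w k) w k.
Proof. unfold nstep, cret. now decode. Qed.

Lemma nstep_code c : nstep (config_code c) = config_code (step c).
Proof.
  destruct c as [e v k|f rgs v ws k|w k]; cbn [config_code].
  - rewrite nstep_ceval. unfold step_eval.
    destruct e as [| |i|f gs|f g|f]; cbn [rf_code]; decode; try reflexivity.
    + destruct v; cbn [code_list]; decode; reflexivity.
    + simpl. now rewrite map_rev.
    + destruct v as [|[|n] v]; cbn [code_list]; decode; reflexivity.
  - rewrite nstep_cargs. unfold step_args, code_arg. decode.
    destruct rgs; cbn [map code_list]; decode; reflexivity.
  - rewrite nstep_cret. unfold step_ret.
    destruct k as [|[f rgs v ws|g n v|f n v] k]; cbn [map code_list]; decode; try reflexivity;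
      cbn [frame_code]; unfold code_arg; decode; try reflexivity.
    destruct w; cbn [Nat.eqb]; reflexivity.
Qed.

Lemma iter_nstep_code n c : Nat.iter n nstep (config_code c) = config_code (Nat.iter n step c).
Proof. induction n as [|n IH]; simpl; [|rewrite IH, nstep_code]; reflexivity. Qed.

Lemma rec1_nstep : rec1 nstep.
Proof.
  unfold nstep, step_eval, step_args, step_ret, cret, cargs, ceval, code_arg, cnth, ccons, chd, ctl.
  rec_auto.
Qed.

(** Values are shifted: [S y] means that [y] has been returned, and 0 that there is no value after
    [s] steps. *)
Definition interp (e x s : nat) : nat :=
  let c := nat_rect (fun _ => nat) (ceval e (ccons x 0) 0) (fun _ c => nstep c) s in
  if (p1 c =? 2) && (p2 (p2 c) =? 0) then S (p1 (p2 c)) else 0.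

Lemma rec3_interp : rec3 interp.
Proof.
  pose proof rec1_nstep.
  unfold interp, ceval, ccons. rec_auto.
Qed.

Lemma interp_spec r x s y : interp (rf_code r) x s = S y <->
  Nat.iter s step (CEval r [x] []) = CRet y [].
Proof.
  unfold interp.
  assert (E : nat_rect (fun _ => nat) (ceval (rf_code r) (ccons x 0) 0) (fun _ c => nstep c) s
    = config_code (Nat.iter s step (CEval r [x] []))) by (now rewrite <- iter_nstep_code).
  rewrite E. clear E.
  destruct (Nat.iter s step (CEval r [x] [])) as [e v k|f rgs v ws k|w [|fr k]];
    cbn [config_code map code_list]; unfold ceval, cargs, cret; decode;
    cbn [andb]; split; intro H; try discriminate; congruence.
Qed.

Lemma interp_eval r x y : eval r [x] y <-> exists s, interp (rf_code r) x s = S y.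
Proof.
  rewrite eval_iff_reach. split; intros [s Hs]; exists s; now apply interp_spec.
Qed.

Lemma interp_mono r x s t y : s <= t ->
  interp (rf_code r) x s = S y -> interp (rf_code r) x t = S y.
Proof. rewrite !interp_spec. apply halted_persists. Qed.

#[export] Hint Resolve rec3_interp : recdb.

(** * Binary strings and the Kraft inequality *)

Lemma is_prefix_cons b c s t : is_prefix (b :: s) (c :: t) <-> b = c /\ is_prefix s t.
Proof.
  split.
  - intros [u Hu]. inversion Hu. split; auto. now exists u.
  - intros [-> [u ->]]. now exists u.
Qed.

Lemma is_prefix_refl s : is_prefix s s.
Proof. exists []. now rewrite app_nil_r. Qed.

Lemma bcode_inj s t : bcode s = bcode t -> s = t.
Proof.
  revert t. induction s as [|b s IH]; intros [|c t]; cbn [bcode]; intro H;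
    try (destruct b; lia); try (destruct c; lia); auto.
  destruct b, c; try lia; f_equal; apply IH; lia.
Qed.

Lemma bcode_surj n : exists s, bcode s = n.
Proof.
  induction n as [n IH] using lt_wf_ind.
  destruct n as [|n]; [now exists []|].
  pose proof (Nat.div_mod n 2 ltac:(lia)) as Hd.
  pose proof (Nat.mod_upper_bound n 2 ltac:(lia)).
  destruct (IH (n / 2)) as [s Hs]; [lia|].
  exists ((n mod 2 =? 1) :: s). cbn [bcode]. rewrite Hs.
  destruct (Nat.eqb_spec (n mod 2) 1); lia.
Qed.

(** Strings of length [l] have the codes from [2^l - 1] to [2^(l+1) - 2]. So length is monotone in
    the code, and enumerating codes lists descriptions by increasing length. *)
Definition blen (j : nat) := Nat.log2 (S j).

Lemma blen_bcode s : blen (bcode s) = length s.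
Proof.
  unfold blen. induction s as [|b s IH]; [reflexivity|]. cbn [bcode length].
  rewrite <- IH. destruct b.
  - replace (S (2 * bcode s + 2)) with (2 * S (bcode s) + 1) by lia.
    apply Nat.log2_succ_double. lia.
  - replace (S (2 * bcode s + 1)) with (2 * S (bcode s)) by lia.
    apply Nat.log2_double. lia.
Qed.

Lemma blen_mono i j : i <= j -> blen i <= blen j.
Proof. intro. apply Nat.log2_le_mono. lia. Qed.

Lemma blen_le j : blen j <= j.
Proof. pose proof (Nat.log2_lt_lin (S j) ltac:(lia)). unfold blen. lia. Qed.

Lemma rec1_blen : rec1 blen.
Proof.
  apply (recfun_ext _ (fun r => bsum (r 0) (fun k => Nat.b2n (2 ^ S k <=? S (r 0))))); [|rec_auto].
  intro r. rewrite bsum_count with (W := blen (r 0)).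
  - apply Nat.min_r, blen_le.
  - intros i _. f_equal. unfold blen.
    destruct (Nat.leb_spec (2 ^ S i) (S (r 0))), (Nat.ltb_spec i (Nat.log2 (S (r 0)))); auto.
    + apply Nat.log2_le_pow2 in H; lia.
    + assert (2 ^ S i <= S (r 0)); [|lia]. apply Nat.log2_le_pow2; lia.
Qed.
#[export] Hint Resolve rec1_blen : recdb.

(** * The Kraft inequality *)

Definition tails (b : bool) (l : list (list bool)) : list (list bool) :=
  flat_map (fun s => match s with
                     | [] => []
                     | c :: t => if Bool.eqb b c then [t] else []
                     end) l.

Lemma in_tails b l t : In t (tails b l) <-> In (b :: t) l.
Proof.
  unfold tails. rewrite in_flat_map. split.
  - intros ([|c u] & Hu & Ht); [easy|].
    destruct (Bool.eqb_spec b c); [|easy].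
    destruct Ht as [<-|[]]. now subst.
  - intro H. exists (b :: t). split; auto. rewrite Bool.eqb_reflx. now left.
Qed.

Lemma NoDup_tails b l : NoDup l -> NoDup (tails b l).
Proof.
  induction 1 as [|s l Hs Hl IH]; [constructor|]. simpl.
  destruct s as [|c t]; auto.
  destruct (Bool.eqb_spec b c); auto. subst c. simpl. constructor; auto.
  now rewrite in_tails.
Qed.

Definition kraft_sum (L : nat) (l : list (list bool)) : nat :=
  list_sum (map (fun s => 2 ^ (L - length s)) l).

Lemma kraft_sum_tails L l : ~ In [] l ->
  kraft_sum (S L) l = kraft_sum L (tails true l) + kraft_sum L (tails false l).
Proof.
  unfold kraft_sum. induction l as [|[|b s] l IH]; intro H; [reflexivity| |].
  - destruct H. now left.
  - assert (Hl : ~ In [] l) by (intro; apply H; now right).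
    cbn [map list_sum fold_right]. cbn [list_sum] in IH.
    change (fold_right Nat.add 0) with list_sum. rewrite (IH Hl).
    destruct b; simpl; lia.
Qed.

(** Induction on the maximal length, splitting by first bit. If the empty string occurs,
    prefix-freeness leaves nothing else. *)
Lemma kraft L l : NoDup l -> (forall s t, In s l -> In t l -> is_prefix s t -> s = t) ->
  (forall s, In s l -> length s <= L) -> kraft_sum L l <= 2 ^ L.
Proof.
  assert (Hnil : forall L (l : list (list bool)), NoDup l -> (forall s, In s l -> s = []) ->
            kraft_sum L l <= 2 ^ L).
  { clear. intros L l Hl H. destruct l as [|s [|t l]].
    - cbn. lia.
    - rewrite (H s) by now left. unfold kraft_sum. simpl. rewrite Nat.sub_0_r. lia.
    - inversion Hl as [|? ? Hs]; subst. destruct Hs. left.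
      rewrite (H s), (H t); simpl; auto. }
  revert l. induction L as [|L IH]; intros l Hl Hp HL.
  - apply Hnil; auto. intros s Hs. destruct s; auto. specialize (HL _ Hs). simpl in HL. lia.
  - destruct (in_dec (list_eq_dec Bool.bool_dec) [] l) as [Hin|Hin].
    + apply Hnil; auto. intros s Hs. symmetry. apply Hp; auto. now exists s.
    + rewrite kraft_sum_tails by auto.
      assert (H : forall b, kraft_sum L (tails b l) <= 2 ^ L).
      { intro b. apply IH.
        - now apply NoDup_tails.
        - intros s t Hs Ht Hst. apply in_tails in Hs, Ht.
          assert (E : b :: s = b :: t) by (apply Hp; auto; now apply is_prefix_cons).
          congruence.
        - intros s Hs. apply in_tails, HL in Hs. simpl in Hs. lia. }
      pose proof (H true). pose proof (H false). simpl. lia.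
Qed.

Lemma kraft_bsum s P :
  (forall a b, P (bcode a) = true -> P (bcode b) = true -> is_prefix a b -> a = b) ->
  bsum s (fun j => if P j then 2 ^ (s - blen j) else 0) <= 2 ^ s.
Proof.
  intro HP.
  assert (H : forall m, exists l, NoDup l /\
    (forall t, In t l -> bcode t < m /\ P (bcode t) = true) /\
    forall L, kraft_sum L l = bsum m (fun j => if P j then 2 ^ (L - blen j) else 0)).
  { induction m as [|m (l & Hl & Hin & Hs)].
    - exists []. repeat split; try constructor; easy.
    - destruct (P m) eqn:Pm.
      + destruct (bcode_surj m) as [t Ht]. exists (t :: l). repeat split.
        * constructor; auto. intro H. apply Hin in H. lia.
        * destruct H as [<-|H]; [lia|]. apply Hin in H. lia.
        * destruct H as [<-|H]; [now rewrite Ht|]. now apply Hin in H.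
        * intro L. rewrite bsum_S, Pm, <- Hs, <- Ht, blen_bcode. unfold kraft_sum. simpl. lia.
      + exists l. repeat split; auto.
        * apply Hin in H. lia.
        * now apply Hin in H.
        * intro L. rewrite bsum_S, Pm, <- Hs. lia. }
  destruct (H s) as (l & Hl & Hin & Hs). rewrite <- Hs.
  apply kraft; auto.
  - intros a b Ha Hb. apply HP; [apply (Hin a Ha) | apply (Hin b Hb)].
  - intros t Ht. apply Hin in Ht. rewrite <- blen_bcode. pose proof (blen_le (bcode t)). lia.
Qed.

(** Most significant bit first, so that taking a prefix is dividing by a power of two, and comparing
    codewords becomes arithmetic. *)
Fixpoint bits (l v : nat) : list bool :=
  match l with
  | 0 => []
  | S l' => ((v / 2 ^ l') mod 2 =? 1) :: bits l' v
  end.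

Definition nbits (l v : nat) : nat :=
  nat_rect (fun _ => nat) 0 (fun i z => 2 * z + 1 + (v / 2 ^ i) mod 2) l.

Lemma bcode_bits l v : bcode (bits l v) = nbits l v.
Proof.
  induction l as [|l IH]; [reflexivity|].
  cbn [bits bcode]. rewrite IH. cbn [nbits nat_rect]. fold (nbits l v).
  pose proof (Nat.mod_upper_bound (v / 2 ^ l) 2 ltac:(lia)).
  destruct (Nat.eqb_spec ((v / 2 ^ l) mod 2) 1); lia.
Qed.

Lemma length_bits l v : length (bits l v) = l.
Proof. induction l; simpl; auto. Qed.

Lemma bits_app l k v : bits (l + k) v = bits l (v / 2 ^ k) ++ bits k v.
Proof.
  induction l as [|l IH]; [reflexivity|]. simpl. rewrite IH.
  rewrite Nat.Div0.div_div, <- Nat.pow_add_r. now rewrite (Nat.add_comm k l).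
Qed.

Lemma bits_inj l v w : v < 2 ^ l -> w < 2 ^ l -> bits l v = bits l w -> v = w.
Proof.
  intros Hv Hw H. rewrite <- (Nat.mod_small v (2 ^ l)), <- (Nat.mod_small w (2 ^ l)) by auto.
  clear Hv Hw. induction l as [|l IH]; [now rewrite !Nat.mod_1_r|].
  pose proof (f_equal (hd false) H) as H1. pose proof (f_equal (@tl bool) H) as H2.
  cbn [bits hd tl] in H1, H2.
  rewrite Nat.pow_succ_r', Nat.mul_comm, !Nat.Div0.mod_mul_r, (IH H2). do 2 f_equal.
  pose proof (Nat.mod_upper_bound (v / 2 ^ l) 2 ltac:(lia)).
  pose proof (Nat.mod_upper_bound (w / 2 ^ l) 2 ltac:(lia)).
  destruct (Nat.eqb_spec ((v / 2 ^ l) mod 2) 1), (Nat.eqb_spec ((w / 2 ^ l) mod 2) 1);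
    try discriminate; lia.
Qed.

Lemma app_inj_length {A} (a b u w : list A) : length a = length b -> a ++ u = b ++ w -> a = b.
Proof.
  intros Hl H. apply (f_equal (firstn (length a))) in H.
  rewrite Hl in H at 2. rewrite !firstn_app, !Nat.sub_diag, !firstn_all in H.
  simpl in H. now rewrite !app_nil_r in H.
Qed.

Lemma bits_prefix l v l' v' : v < 2 ^ l -> v' < 2 ^ l' ->
  is_prefix (bits l v) (bits l' v') -> l <= l' /\ v = v' / 2 ^ (l' - l).
Proof.
  intros Hv Hv' [u Hu].
  assert (Hl : l' = l + length u).
  { rewrite <- (length_bits l' v'), Hu, length_app, length_bits. reflexivity. }
  split; [lia|]. replace (l' - l) with (length u) by lia.
  rewrite Hl, bits_app in Hu. apply app_inj_length in Hu; [|now rewrite !length_bits].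
  apply (bits_inj l); auto.
  apply Nat.Div0.div_lt_upper_bound. now rewrite <- Nat.pow_add_r, Nat.add_comm, <- Hl.
Qed.

Definition tag (e : nat) (s : list bool) : list bool := repeat false e ++ true :: s.
Definition ntag (e m : nat) : nat := nat_rect (fun _ => nat) (2 * m + 2) (fun _ z => 2 * z + 1) e.

Lemma bcode_tag e s : bcode (tag e s) = ntag e (bcode s).
Proof.
  induction e as [|e IH]; [reflexivity|].
  change (tag (S e) s) with (false :: tag e s). cbn [bcode]. rewrite IH. reflexivity.
Qed.

Lemma length_tag e s : length (tag e s) = e + 1 + length s.
Proof. unfold tag. rewrite length_app, repeat_length. simpl. lia. Qed.

Lemma tag_prefix e s e' s' : is_prefix (tag e s) (tag e' s') -> e = e' /\ is_prefix s s'.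
Proof.
  revert e'. induction e as [|e IH]; intros [|e']; intro H.
  - now apply is_prefix_cons in H.
  - now apply is_prefix_cons in H.
  - now apply is_prefix_cons in H.
  - apply is_prefix_cons in H as [_ H]. apply IH in H as [-> H]. auto.
Qed.

Lemma tag_inj e s e' s' : tag e s = tag e' s' -> e = e' /\ s = s'.
Proof.
  intro H. destruct (tag_prefix e s e' s') as [-> _]; [rewrite H; apply is_prefix_refl|].
  split; auto. apply app_inv_head in H. congruence.
Qed.

Lemma rec2_nbits : rec2 nbits.
Proof. unfold nbits. rec_auto. Qed.
Lemma rec2_ntag : rec2 ntag.
Proof. unfold ntag. rec_auto. Qed.
#[export] Hint Resolve rec2_nbits rec2_ntag : recdb.

(** * Programs from unbounded search *)

Lemma eval_mu_rec2 f : rec2 f ->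
  exists e, forall n w, eval e [n] w <-> f w n = 0 /\ forall m, m < w -> f m n <> 0.
Proof.
  intros [e He].
  assert (Hf : forall w n, eval e [w; n] (f w n)).
  { intros w n. exact (He (scons w (fun _ => n))). }
  exists (RMu e). intros n w. split.
  - intro H. inversion H as [| | | | | |? ? ? H0 Hm]; subst. split.
    + exact (eval_det _ _ _ _ (Hf w n) H0).
    + intros m Hmw. destruct (Hm m Hmw) as [z Hz].
      now rewrite (eval_det _ _ _ _ (Hf m n) Hz).
  - intros [H0 Hm]. constructor.
    + rewrite <- H0. apply Hf.
    + intros m Hmw. exists (pred (f m n)).
      replace (S (pred (f m n))) with (f m n) by (specialize (Hm m Hmw); lia). apply Hf.
Qed.

(** An equivalence, because prefix-freeness of the machine also needs to know that it halts on no
    other input. *)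
Lemma eval_search test out : rec2 test -> rec1 out ->
  exists e, forall n y, eval e [n] y <->
    exists w, (test w n = 0 /\ forall m, m < w -> test m n <> 0) /\ y = out w.
Proof.
  intros Ht [eo Ho]. destruct (eval_mu_rec2 test Ht) as [et Het].
  assert (Hout : forall w, eval eo [w] (out w)) by (intro w; exact (Ho (fun _ => w))).
  exists (RComp eo [et]). intros n y. split.
  - intro H. inversion H as [| | |? ? ? ws ? Hws Hy| | |]; subst.
    inversion Hws as [|? ? ? w ws' Hw Hnil]; subst. inversion Hnil; subst.
    exists w. split; [now apply Het|]. exact (eval_det _ _ _ _ Hy (Hout w)).
  - intros (w & Hw & ->). econstructor; [|apply Hout].
    constructor; [now apply Het | constructor].
Qed.

Lemma least_zero (f : nat -> nat) : (exists n, f n = 0) ->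
  exists n, f n = 0 /\ forall m, m < n -> f m <> 0.
Proof.
  intros [n Hn]. induction n as [n IH] using lt_wf_ind.
  destruct (classic (exists m, m < n /\ f m = 0)) as [(m & Hm & H0)|H].
  - now apply (IH m).
  - exists n. split; auto. intros m Hm H0. apply H. now exists m.
Qed.

(** * A K-trivial c.e. set *)

Definition zcode (k : nat) : nat := nat_rect (fun _ => nat) 0 (fun _ z => S (cpair 0 z)) k.

Lemma zcode_repeat k : zcode k = code_list (repeat 0 k).
Proof. induction k as [|k IH]; [reflexivity|]. simpl. now rewrite <- IH. Qed.

Lemma zcode_S k : zcode k < zcode (S k).
Proof. simpl. pose proof (cpair_ge_r 0 (zcode k)). fold (zcode k). lia. Qed.

Lemma zcode_lt i k : zcode i < zcode k <-> i < k.
Proof.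
  assert (H : forall i k, i < k -> zcode i < zcode k).
  { induction 1; [apply zcode_S|]. pose proof (zcode_S m). lia. }
  split; auto. intro Hz. destruct (Nat.lt_ge_cases i k) as [|Hk]; auto.
  destruct (Nat.eq_dec i k) as [->|]; [lia|]. specialize (H k i ltac:(lia)). lia.
Qed.

Lemma zcode_ge k : k <= zcode k.
Proof. induction k as [|k IH]; [cbn; lia|]. pose proof (zcode_S k). lia. Qed.

Definition zlen (y : nat) : nat := bsum y (fun k => Nat.b2n (zcode k <? y)).

Lemma zlen_zcode k : zlen (zcode k) = k.
Proof.
  unfold zlen. rewrite bsum_count with (W := k).
  - apply Nat.min_r, zcode_ge.
  - intros i _. f_equal. pose proof (zcode_lt i k).
    destruct (Nat.ltb_spec (zcode i) (zcode k)), (Nat.ltb_spec i k); auto; lia.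
Qed.

Lemma rec1_zcode : rec1 zcode.
Proof. unfold zcode. rec_auto. Qed.
#[export] Hint Resolve rec1_zcode : recdb.
Lemma rec1_zlen : rec1 zlen.
Proof. unfold zlen. rec_auto. Qed.
#[export] Hint Resolve rec1_zlen : recdb.

(* Builds the code from the last entry on, as [code_list] nests to the right. *)
Lemma code_list_restr f k :
  nat_rect (fun _ => nat) 0 (fun i z => S (cpair (f (k - S i)) z)) k = code_list (restr f k).
Proof.
  assert (H : forall i, i <= k ->
    nat_rect (fun _ => nat) 0 (fun i z => S (cpair (f (k - S i)) z)) i
    = code_list (map f (seq (k - i) i))).
  { induction i as [|i IH]; intro Hi; [reflexivity|].
    cbn [nat_rect]. rewrite IH by lia. simpl.
    replace (S (k - S i)) with (k - i) by lia. reflexivity. }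
  rewrite H by auto. unfold restr. now rewrite Nat.sub_diag.
Qed.

Section Construction.

Variable U : rf.
Hypothesis HU : optimal_pf U.

Definition output (j s : nat) : nat := interp (rf_code U) j s.

(** All descriptions with output above [n] are counted (the extra 1 undoes the shift in [interp]).
    They include those of [0^k] for [k > n], as [k <= zcode k], and zero strings need not be
    recognised. *)
Definition cost (n s : nat) : nat :=
  bsum s (fun j => if n + 1 <? output j s then 2 ^ (s - blen j) else 0).

(* Stage [s] is devoted to the number [n = p1 s], a candidate for the
   requirement [e = p1 (p1 s)]; [cost n s] is scaled by [2 ^ s]. *)
Definition wants (s : nat) : bool :=
  (interp (p1 (p1 s)) (p1 s) s =? 1) && (cost (p1 s) s * 2 ^ p1 (p1 s) <=? 2 ^ s).

(** Asking that no earlier stage wants to act, rather than acts, avoids a recursion: the first wish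
    of a requirement is always granted. *)
Definition acts (s : nat) : bool :=
  wants s && (bsum s (fun t => Nat.b2n (wants t && (p1 (p1 t) =? p1 (p1 s)))) =? 0).

Definition enumerated (s n : nat) : bool :=
  0 <? bsum s (fun t => Nat.b2n (acts t && (p1 t =? n))).

Lemma rec2_output : rec2 output.
Proof. unfold output. rec_auto. Qed.
#[local] Hint Resolve rec2_output : recdb.
Lemma rec2_cost : rec2 cost.
Proof. unfold cost. rec_auto. Qed.
#[local] Hint Resolve rec2_cost : recdb.
Lemma rec1_wants : rec1 (fun s => Nat.b2n (wants s)).
Proof. unfold wants. rec_auto. Qed.
Lemma recfun_wants k A : recfun k A -> recfun k (fun r => Nat.b2n (wants (A r))).
Proof. apply (recfun_app1 (fun s => Nat.b2n (wants s))), rec1_wants. Qed.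
Lemma rec1_acts : rec1 (fun s => Nat.b2n (acts s)).
Proof.
  unfold acts. rec_auto; apply recfun_wants; rec_auto.
Qed.
Lemma recfun_acts k A : recfun k A -> recfun k (fun r => Nat.b2n (acts (A r))).
Proof. apply (recfun_app1 (fun s => Nat.b2n (acts s))), rec1_acts. Qed.
Lemma rec2_enumerated : rec2 (fun s n => Nat.b2n (enumerated s n)).
Proof.
  unfold enumerated. rec_auto; apply recfun_acts; rec_auto.
Qed.

Lemma output_mono j s t y : s <= t -> output j s = S y -> output j t = S y.
Proof. apply interp_mono. Qed.

Lemma output_run j s y t : output j s = S y -> bcode t = j -> run U t y.
Proof. intros H <-. apply interp_eval. now exists s. Qed.

Lemma output_unique j s t y z : output j s = S y -> output j t = S z -> y = z.
Proof.
  intros H1 H2. apply (output_mono _ _ (s + t)) in H1; [|lia].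
  apply (output_mono _ _ (s + t)) in H2; [|lia]. congruence.
Qed.

Lemma output_prefix a b s t : 0 < output (bcode a) s -> 0 < output (bcode b) t ->
  is_prefix a b -> a = b.
Proof.
  intros Ha Hb Hp.
  destruct (output (bcode a) s) as [|y] eqn:Ea; [lia|].
  destruct (output (bcode b) t) as [|z] eqn:Eb; [lia|].
  destruct HU as [Hpf _]. eapply Hpf; eauto using output_run.
Qed.

Lemma bounded_max (f : nat -> nat) B : (forall s, f s <= B) ->
  exists m, forall s, f s <= f m.
Proof.
  intro HB. apply NNPP. intro H.
  assert (Hk : forall k, exists s, k <= f s).
  { induction k as [|k [s Hs]]; [exists 0; lia|].
    apply NNPP. intro Hn. apply H. exists s. intro t.
    destruct (Nat.le_gt_cases (f t) (f s)); auto.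
    destruct Hn. exists t. lia. }
  destruct (Hk (S B)) as [s Hs]. specialize (HB s). lia.
Qed.

(* By Kraft the scaled total weight of the domain of U, truncated to a
   multiple of [2 ^ - e], takes its maximum at some stage; the descriptions
   that converge after this stage weigh at most [2 ^ - e]. *)
Lemma cost_limit e : exists n0, forall n s, n0 <= n -> cost n s * 2 ^ e <= 2 ^ s.
Proof.
  pose (total := fun s => bsum s (fun j => if 0 <? output j s then 2 ^ (s - blen j) else 0)).
  assert (Hk : forall s, total s <= 2 ^ s).
  { intro s. apply (kraft_bsum s (fun j => 0 <? output j s)).
    intros a b Ha Hb. apply Nat.ltb_lt in Ha, Hb. now apply output_prefix with s s. }
  destruct (bounded_max (fun s => total s * 2 ^ e / 2 ^ s) (2 ^ e)) as [s0 Hs0].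
  { intro s. apply Nat.Div0.div_le_upper_bound. apply Nat.mul_le_mono_r, Hk. }
  (* The sum bounds every output seen by stage [s0], so for larger [n] the cost counts only
     descriptions that converge later. *)
  exists (bsum s0 (fun j => output j s0)). intros n s Hn.
  assert (Hout : forall j, j < s0 -> output j s0 <= n).
  { intros j Hj. transitivity (bsum s0 (fun j => output j s0)); auto.
    now apply (bsum_term s0 (fun j => output j s0)). }
  destruct (Nat.le_gt_cases s0 s) as [Hs|Hs].
  - assert (Ht : cost n s + total s0 * 2 ^ (s - s0) <= total s).
    { unfold total at 1. rewrite bsum_mul.
      replace (bsum s0 _) with (bsum s (fun j => if (j <? s0) && (0 <? output j s0)
        then 2 ^ (s - blen j) else 0)).
      - unfold cost. rewrite bsum_plus. apply bsum_le. intros j Hj.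
        destruct (Nat.ltb_spec j s0) as [Hj0|]; cbn [andb].
        + specialize (Hout j Hj0). destruct (output j s0) as [|y] eqn:E.
          * change (0 <? 0) with false. destruct (Nat.ltb_spec (n + 1) (output j s)), (Nat.ltb_spec 0 (output j s)); lia.
          * rewrite (output_mono j s0 s y Hs E).
            change (0 <? S y) with true. destruct (Nat.ltb_spec (n + 1) (S y)); lia.
        + destruct (Nat.ltb_spec (n + 1) (output j s)), (Nat.ltb_spec 0 (output j s)); lia.
      - rewrite (bsum_extend s0 s); auto.
        + apply bsum_ext. intros j Hj. destruct (Nat.ltb_spec j s0); [|lia]. cbn [andb].
          destruct (0 <? output j s0); [|reflexivity].
          rewrite <- Nat.pow_add_r. f_equal. pose proof (blen_le j). lia.
        + intros i Hi _. destruct (Nat.ltb_spec i s0); [lia|reflexivity]. }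
    specialize (Hs0 s). cbv beta in Hs0.
    pose proof (Nat.pow_nonzero 2 s ltac:(lia)) as H2s.
    pose proof (Nat.pow_nonzero 2 s0 ltac:(lia)) as H2s0.
    pose proof (Nat.div_mod (total s * 2 ^ e) (2 ^ s) H2s) as D1.
    pose proof (Nat.mod_upper_bound (total s * 2 ^ e) (2 ^ s) H2s) as D2.
    pose proof (Nat.Div0.mul_div_le (total s0 * 2 ^ e) (2 ^ s0)) as D3.
    assert (E : 2 ^ s = 2 ^ s0 * 2 ^ (s - s0)) by (rewrite <- Nat.pow_add_r; f_equal; lia).
    set (q := total s0 * 2 ^ e / 2 ^ s0) in *.
    set (q' := total s * 2 ^ e / 2 ^ s) in *.
    (* Maximality gives [q' <= q]. The old descriptions already account for [2 ^ s * q'], and what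
       is left of the total is a remainder modulo [2 ^ s]. *)
    assert (D4 : 2 ^ s * q' <= total s0 * 2 ^ (s - s0) * 2 ^ e).
    { transitivity (2 ^ s * q); [now apply Nat.mul_le_mono_l|].
      rewrite E. replace (2 ^ s0 * 2 ^ (s - s0) * q) with (2 ^ s0 * q * 2 ^ (s - s0)) by ring.
      replace (total s0 * 2 ^ (s - s0) * 2 ^ e) with (total s0 * 2 ^ e * 2 ^ (s - s0)) by ring.
      now apply Nat.mul_le_mono_r. }
    apply (Nat.mul_le_mono_r _ _ (2 ^ e)) in Ht. rewrite Nat.mul_add_distr_r in Ht. lia.
  - unfold cost. rewrite (proj2 (bsum_zero _ _)); [lia|].
    intros j Hj. destruct (Nat.ltb_spec (n + 1) (output j s)); auto.
    destruct (output j s) as [|y] eqn:E; [lia|].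
    specialize (Hout j ltac:(lia)). rewrite (output_mono j s s0 y ltac:(lia) E) in Hout. lia.
Qed.

Lemma acts_spec s : acts s = true <->
  wants s = true /\ forall t, t < s -> wants t = true -> p1 (p1 t) <> p1 (p1 s).
Proof.
  unfold acts. rewrite andb_true_iff, Nat.eqb_eq, bsum_zero.
  split; intros [Hw H]; split; auto; intros t Ht.
  - intros Hwt E. specialize (H t Ht). rewrite Hwt, E, Nat.eqb_refl in H. discriminate.
  - specialize (H t Ht). destruct (wants t); auto. cbn [andb].
    destruct (Nat.eqb_spec (p1 (p1 t)) (p1 (p1 s))); auto. now destruct H.
Qed.

Lemma acts_unique s t : acts s = true -> acts t = true -> p1 (p1 s) = p1 (p1 t) -> s = t.
Proof.
  rewrite !acts_spec. intros [Hs Hs'] [Ht Ht'] E.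
  destruct (Nat.lt_total s t) as [H|[H|H]]; auto.
  - now destruct (Ht' s H Hs).
  - now destruct (Hs' t H Ht).
Qed.

Lemma enumerated_spec s n : enumerated s n = true <->
  exists t, t < s /\ acts t = true /\ p1 t = n.
Proof.
  unfold enumerated. rewrite Nat.ltb_lt, bsum_pos.
  split; intros (t & Ht & H); exists t; split; auto.
  - destruct (acts t); [|cbn in H; lia]. cbn [andb] in H.
    destruct (Nat.eqb_spec (p1 t) n); [auto | cbn in H; lia].
  - destruct H as [-> ->]. rewrite Nat.eqb_refl. cbn. lia.
Qed.

Definition limit_set (n : nat) : bool :=
  if excluded_middle_informative (exists t, acts t = true /\ p1 t = n) then true else false.

Lemma limit_set_spec n : limit_set n = true <-> exists t, acts t = true /\ p1 t = n.
Proof.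
  unfold limit_set. destruct excluded_middle_informative; split; auto; easy.
Qed.

(** Let [e] code a program for the set. If [e] acts, it enumerates a number on which the program
    says 0. Otherwise a large number of column [e] stays out, the program says 0 on it, and the cost
    bound eventually lets [e] act. *)
Lemma limit_set_not_rec : ~ rec1 (fun n => Nat.b2n (limit_set n)).
Proof.
  intros [r Hr].
  assert (Hv : forall n, eval r [n] (Nat.b2n (limit_set n))) by (intro n; exact (Hr (fun _ => n))).
  clear Hr. set (e := rf_code r).
  assert (Hval : forall n s, interp e n s = 1 -> limit_set n = false).
  { intros n s H. assert (Hn : eval r [n] 0) by (apply interp_eval; now exists s).
    pose proof (eval_det _ _ _ _ Hn (Hv n)). now destruct (limit_set n). }
  destruct (classic (exists s, acts s = true /\ p1 (p1 s) = e)) as [(s & Hs & He)|Hno].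
  - assert (Hin : limit_set (p1 s) = true) by (apply limit_set_spec; now exists s).
    apply acts_spec in Hs as [Hs _]. unfold wants in Hs. rewrite He in Hs.
    apply andb_true_iff in Hs as [Hs _]. apply Nat.eqb_eq in Hs.
    apply Hval in Hs. congruence.
  - destruct (cost_limit e) as [n0 Hn0].
    set (n := cpair e n0).
    assert (Hpn : p1 n = e) by apply p1_cpair.
    assert (Hn0n : n0 <= n) by apply cpair_ge_r.
    clearbody n.
    assert (Hn : limit_set n = false).
    { destruct (limit_set n) eqn:E; auto. apply limit_set_spec in E as (t & Ht & E).
      destruct Hno. exists t. split; auto. now rewrite E. }
    assert (H0 : exists s, interp e n s = 1).
    { apply interp_eval. specialize (Hv n). now rewrite Hn in Hv. }
    destruct H0 as [s0 H0].
    assert (Hw : wants (cpair n s0) = true).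
    { unfold wants. rewrite p1_cpair, Hpn.
      apply andb_true_iff. split.
      - apply Nat.eqb_eq. apply interp_mono with s0; auto. apply cpair_ge_r.
      - now apply Nat.leb_le, Hn0. }
    assert (Hz : exists s, (if wants s && (p1 (p1 s) =? e) then 0 else 1) = 0).
    { exists (cpair n s0). now rewrite Hw, p1_cpair, Hpn, Nat.eqb_refl. }
    apply (least_zero (fun s => if wants s && (p1 (p1 s) =? e) then 0 else 1)) in Hz
      as (s & Hs & Hmin).
    destruct (wants s) eqn:Hws; [|discriminate]. cbn [andb] in Hs.
    destruct (Nat.eqb_spec (p1 (p1 s)) e) as [He|]; [|discriminate].
    apply Hno. exists s. split; auto. apply acts_spec. split; auto.
    intros t Ht Hwt E. apply (Hmin t Ht). rewrite Hwt, E, He, Nat.eqb_refl. reflexivity.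
Qed.

(* The numbers [j] described at an acting stage [s] code the descriptions [t]
   whose outputs [U t = 0^k], [k > p1 s], must be matched by new ones of about
   the same length.  As they are enumerated by increasing length, the sums
   [vsum s j] are integers, and they are the offsets of the Kraft code. *)
Definition described (s j : nat) : bool := (j <? s) && (p1 s + 1 <? output j s).

Definition vsum (s j : nat) : nat :=
  bsum j (fun i => if p1 s + 1 <? output i s then 2 ^ (blen j - blen i) else 0).

Definition codeword (s j : nat) : list bool :=
  tag (S (p1 (p1 s))) (bits (blen j - p1 (p1 s)) (vsum s j)).

(** Give [i] the dyadic interval of length [2 ^ - blen i] with left end [vsum s i * 2 ^ - blen i]:
    these intervals lie side by side in the order of the codes. *)
Lemma vsum_step s i j : described s i = true -> i < j ->
  2 ^ (blen j - blen i) * (vsum s i + 1) <= vsum s j.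
Proof.
  intros Hd Hij. apply andb_true_iff in Hd as [_ Hd].
  unfold vsum at 2. etransitivity; [|apply (bsum_mono_n (S i)); exact Hij].
  rewrite bsum_S, Hd, Nat.mul_add_distr_l, Nat.mul_1_r. apply Nat.add_le_mono_r.
  unfold vsum. rewrite Nat.mul_comm, bsum_mul. apply bsum_le.
  intros m Hm. destruct (p1 s + 1 <? output m s); [|lia].
  rewrite <- Nat.pow_add_r. apply Nat.pow_le_mono_r; [lia|].
  pose proof (blen_mono m i ltac:(lia)). pose proof (blen_mono i j ltac:(lia)). lia.
Qed.

(** All intervals fit into the initial segment of length [2 ^ - e] of the unit interval, by the cost
    bound. Their addresses thus begin with [e] zeros, and these are the bits that [codeword]
    drops. *)
Lemma vsum_bound s j : acts s = true -> described s j = true ->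
  p1 (p1 s) <= blen j /\ vsum s j < 2 ^ (blen j - p1 (p1 s)).
Proof.
  intros Ha Hd. apply andb_true_iff in Hd as [Hj Hd]. apply Nat.ltb_lt in Hj.
  apply acts_spec in Ha as [Hw _]. unfold wants in Hw.
  apply andb_true_iff in Hw as [_ Hc]. apply Nat.leb_le in Hc.
  set (e := p1 (p1 s)) in *.
  assert (H : (vsum s j + 1) * 2 ^ (s - blen j) <= cost (p1 s) s).
  { unfold cost. etransitivity; [|apply (bsum_mono_n (S j)); exact Hj].
    rewrite bsum_S, Hd, Nat.mul_add_distr_r, Nat.mul_1_l. apply Nat.add_le_mono_r.
    unfold vsum. rewrite bsum_mul. apply bsum_le. intros i Hi.
    destruct (p1 s + 1 <? output i s); [|lia].
    rewrite <- Nat.pow_add_r. apply Nat.pow_le_mono_r; [lia|].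
    pose proof (blen_mono i j ltac:(lia)). pose proof (blen_le j). lia. }
  pose proof (blen_le j) as Hb.
  assert (H2 : (vsum s j + 1) * 2 ^ e * 2 ^ (s - blen j) <= 2 ^ blen j * 2 ^ (s - blen j)).
  { rewrite <- Nat.pow_add_r. replace (blen j + (s - blen j)) with s by lia.
    etransitivity; [|exact Hc]. apply (Nat.mul_le_mono_r _ _ (2 ^ e)) in H. lia. }
  apply Nat.mul_le_mono_pos_r in H2; [|pose proof (Nat.pow_nonzero 2 (s - blen j)); lia].
  assert (He : e <= blen j).
  { apply (Nat.pow_le_mono_r_iff 2); [lia|]. nia. }
  split; auto.
  replace (blen j) with ((blen j - e) + e) in H2 at 1 by lia. rewrite Nat.pow_add_r in H2.
  apply Nat.mul_le_mono_pos_r in H2; [lia|]. pose proof (Nat.pow_nonzero 2 e). lia.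
Qed.

Lemma codeword_prefix_aux s i j : acts s = true ->
  described s i = true -> described s j = true -> i < j ->
  ~ is_prefix (codeword s i) (codeword s j) /\ ~ is_prefix (codeword s j) (codeword s i).
Proof.
  intros Ha Hi Hj Hij.
  destruct (vsum_bound s i Ha Hi) as [Ei Vi], (vsum_bound s j Ha Hj) as [Ej Vj].
  pose proof (vsum_step s i j Hi Hij) as Hs.
  pose proof (blen_mono i j ltac:(lia)) as Hl.
  unfold codeword. set (e := p1 (p1 s)) in *.
  split; intro H; apply tag_prefix in H as [_ H]; apply bits_prefix in H as [H1 H2]; auto.
  - replace (blen j - e - (blen i - e)) with (blen j - blen i) in H2 by lia.
    pose proof (Nat.pow_nonzero 2 (blen j - blen i) ltac:(lia)).
    pose proof (Nat.div_le_lower_bound _ _ _ H Hs). lia.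
  - replace (blen i - e - (blen j - e)) with 0 in H2 by lia.
    replace (blen j - blen i) with 0 in Hs by lia. simpl Nat.pow in *.
    rewrite Nat.div_1_r in H2. lia.
Qed.

Lemma codeword_prefix s i t j : acts s = true -> acts t = true ->
  described s i = true -> described t j = true ->
  is_prefix (codeword s i) (codeword t j) -> s = t /\ i = j.
Proof.
  intros Hs Ht Hi Hj Hp.
  destruct (tag_prefix _ _ _ _ Hp) as [E _]. injection E as E.
  apply acts_unique in E; auto. subst t. split; auto.
  destruct (Nat.lt_total i j) as [H|[H|H]]; auto.
  - now destruct (codeword_prefix_aux s i j Hs Hi Hj H).
  - now destruct (codeword_prefix_aux s j i Hs Hj Hi H).
Qed.

(* [G f k] is meant to be the [k]-th term of a Cauchy name built from [f]. *)
Variable G : (nat -> bool) -> nat -> nat.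
Hypothesis G_local : forall f g k, (forall m, m < k -> f m = g m) -> G f k = G g k.
Hypothesis G_rec : forall A : nat -> nat -> bool,
  rec2 (fun s n => Nat.b2n (A s n)) -> rec2 (fun s k => G (A s) k).

(** * The prefix-free machine and the K-triviality of the limit *)

Definition approx_code (s k : nat) : nat := code_list (restr (G (enumerated s)) k).

Lemma rec2_approx_code : rec2 approx_code.
Proof.
  pose proof (G_rec _ rec2_enumerated) as HG.
  apply (recfun_ext _ (fun r => nat_rect (fun _ => nat) 0
    (fun i z => S (cpair ((fun s k => G (enumerated s) k) (r 0) (r 1 - S i)) z)) (r 1))).
  - intro r. apply (code_list_restr (G (enumerated (r 0)))).
  - apply (recfun_rec 2 (fun r => r 1) (fun _ => 0) (fun r i z =>
      S (cpair ((fun s k => G (enumerated s) k) (r 0) (r 1 - S i)) z))); try (now rec_auto).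
    apply recfun_succ, (recfun_app2 cpair); [auto with recdb | | now rec_auto].
    apply (recfun_app2 (fun s k => G (enumerated s) k)); auto; rec_auto.
Qed.

(** The witness [w] codes a mode, a stage [s] and a description [j]. In mode 0 the input is [j]
    itself under tag 0, otherwise the codeword given to [j] at the acting stage [s]. *)
Definition test (w n : nat) : nat :=
  if p1 w =? 0 then
    (if (p2 (p2 w) <? p1 (p2 w)) && (0 <? output (p2 (p2 w)) (p1 (p2 w)))
        && (n =? ntag 0 (p2 (p2 w))) then 0 else 1)
  else
    (if acts (p1 (p2 w))
        && ((p2 (p2 w) <? p1 (p2 w)) && (p1 (p1 (p2 w)) + 1 <? output (p2 (p2 w)) (p1 (p2 w))))
        && (n =? ntag (S (p1 (p1 (p1 (p2 w)))))
              (nbits (blen (p2 (p2 w)) - p1 (p1 (p1 (p2 w)))) (vsum (p1 (p2 w)) (p2 (p2 w)))))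
     then 0 else 1).

(** [enumerated s] holds what entered before stage [s], so a codeword issued at stage [s] must use
    [S s] to include the change made there. *)
Definition result (w : nat) : nat :=
  approx_code (if p1 w =? 0 then p1 (p2 w) else S (p1 (p2 w)))
    (zlen (pred (output (p2 (p2 w)) (p1 (p2 w))))).

Lemma rec2_test : rec2 test.
Proof.
  assert (rec2 vsum) by (unfold vsum; rec_auto).
  unfold test. rec_auto. apply recfun_acts. rec_auto.
Qed.

Lemma rec1_result : rec1 result.
Proof. pose proof rec2_approx_code. unfold result. rec_auto. Qed.

Lemma test_inv w a : test w (bcode a) = 0 ->
  let s := p1 (p2 w) in let j := p2 (p2 w) in
  (p1 w = 0 /\ j < s /\ 0 < output j s /\ exists t, bcode t = j /\ a = tag 0 t) \/
  (p1 w <> 0 /\ acts s = true /\ described s j = true /\ a = codeword s j).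
Proof.
  intros H s j. unfold test in H. fold s j in H. fold (described s j) in H.
  destruct (Nat.eqb_spec (p1 w) 0) as [E|E].
  - left. destruct (_ && _) eqn:T in H; [|discriminate].
    apply andb_true_iff in T as [T1 T2]. apply andb_true_iff in T1 as [T0 T1].
    apply Nat.ltb_lt in T0, T1. apply Nat.eqb_eq in T2.
    destruct (bcode_surj j) as [t Ht]. repeat split; auto. exists t. split; auto.
    apply bcode_inj. now rewrite T2, bcode_tag, Ht.
  - right. destruct (_ && _) eqn:T in H; [|discriminate].
    apply andb_true_iff in T as [T1 T2]. apply andb_true_iff in T1 as [T0 T1].
    apply Nat.eqb_eq in T2. repeat split; auto.
    apply bcode_inj. unfold codeword. now rewrite bcode_tag, bcode_bits.
Qed.

Lemma test_base s t : bcode t < s -> 0 < output (bcode t) s ->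
  test (cpair 0 (cpair s (bcode t))) (bcode (tag 0 t)) = 0.
Proof.
  intros H1 H2. unfold test. rewrite !p2_cpair, !p1_cpair.
  apply Nat.ltb_lt in H1, H2. rewrite H1, H2, bcode_tag, !Nat.eqb_refl. reflexivity.
Qed.

Lemma test_codeword s j : acts s = true -> described s j = true ->
  test (cpair 1 (cpair s j)) (bcode (codeword s j)) = 0.
Proof.
  intros H1 H2. unfold test. rewrite !p2_cpair, !p1_cpair.
  unfold described in H2. rewrite H1, H2. unfold codeword.
  rewrite bcode_tag, bcode_bits, Nat.eqb_refl. reflexivity.
Qed.

Lemma last_change s k :
  (forall n, n < k -> enumerated s n = limit_set n) \/
  exists t, s <= t /\ acts t = true /\ p1 t < k /\
    forall n, n < k -> enumerated (S t) n = limit_set n.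
Proof.
  destruct (classic (exists t, s <= t /\ acts t = true /\ p1 t < k)) as [H|H].
  - right.
    (* A stage is determined by the requirement acting at it, hence by the number enumerated; so
       only finitely many stages act below [k]. *)
    assert (HB : exists B, forall t, acts t = true -> p1 t < k -> t < B).
    { clear H. induction k as [|k [B HB]]; [exists 0; intros; lia|].
      destruct (classic (exists t, acts t = true /\ p1 t = k)) as [(t & Ht & E)|Hn].
      - exists (B + S t). intros u Hu Huk. destruct (Nat.eq_dec (p1 u) k) as [Eu|].
        + rewrite (acts_unique u t Hu Ht) by congruence. lia.
        + specialize (HB u Hu ltac:(lia)). lia.
      - exists B. intros u Hu Huk. destruct (Nat.eq_dec (p1 u) k) as [Eu|].
        + destruct Hn. now exists u.
        + apply HB; auto. lia. }
    destruct HB as [B HB].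
    pose (P t := s <= t /\ acts t = true /\ p1 t < k).
    assert (Hmax : exists t, P t /\ forall u, P u -> u <= t).
    { destruct (bounded_max (fun t => if excluded_middle_informative (P t) then S t else 0) B)
        as [t Ht].
      - intro u. destruct excluded_middle_informative as [(_ & H1 & H2)|]; [|lia].
        now apply HB.
      - destruct H as [u0 Hu0]. exists t.
        cbv beta in Ht. revert Ht. destruct (excluded_middle_informative (P t)) as [Pt|Pt]; intro Ht.
        + split; auto. intros u Pu. specialize (Ht u). revert Ht.
          destruct (excluded_middle_informative (P u)); [lia|easy].
        + specialize (Ht u0). revert Ht.
          destruct (excluded_middle_informative (P u0)); [lia|easy]. }
    destruct Hmax as (t & (H1 & H2 & H3) & Hmax). exists t. repeat split; auto.
    intros n Hn. apply eq_true_iff_eq. rewrite enumerated_spec, limit_set_spec. split.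
    + intros (u & _ & Hu). now exists u.
    + intros (u & Hu & E). exists u. repeat split; auto.
      destruct (Nat.lt_ge_cases u (S t)) as [|Hge]; auto.
      subst n. assert (u <= t) by (apply Hmax; repeat split; auto; lia). lia.
  - left. intros n Hn. apply eq_true_iff_eq. rewrite enumerated_spec, limit_set_spec. split.
    + intros (u & _ & Hu). now exists u.
    + intros (u & Hu & E). exists u. repeat split; auto.
      destruct (Nat.lt_ge_cases u s) as [|Hge]; auto.
      destruct H. exists u. subst n. auto.
Qed.

Lemma approx_code_limit s k : (forall n, n < k -> enumerated s n = limit_set n) ->
  approx_code s k = code_list (restr (G limit_set) k).
Proof.
  intro H. unfold approx_code, restr. f_equal. apply map_ext_in. intros i Hi.
  apply in_seq in Hi. apply G_local. intros m Hm. apply H. lia.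
Qed.

Lemma K_trivial_limit : K_trivial_fun U (G limit_set).
Proof.
  destruct (eval_search test result rec2_test rec1_result) as [M HM].
  assert (Hpf : prefix_free M).
  { intros a b y z Ha Hb Hp. apply HM in Ha as (w & [Hw _] & _). apply HM in Hb as (v & [Hv _] & _).
    apply test_inv in Hw as [(_ & _ & Ow & t & Et & ->)|(_ & Aw & Dw & ->)];
    apply test_inv in Hv as [(_ & _ & Ov & u & Eu & ->)|(_ & Av & Dv & ->)].
    - apply tag_prefix in Hp as [_ Hp]. f_equal.
      rewrite <- Et in Ow. rewrite <- Eu in Ov. eapply output_prefix; eauto.
    - now apply tag_prefix in Hp.
    - now apply tag_prefix in Hp.
    - now destruct (codeword_prefix _ _ _ _ Aw Av Dw Dv Hp) as [-> ->]. }
  (* Tag 0 costs one bit, and tag [S e] costs [e + 2] bits against the [e] dropped; [c] is the price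
     of passing from [M] to [U]. *)
  destruct (proj2 HU M Hpf) as [c Hc]. exists (2 + c). intros k l (t & Ht & Hl).
  replace (l + (2 + c)) with (l + 2 + c) by lia. apply Hc. clear c Hc.
  rewrite <- zcode_repeat in Ht. apply interp_eval in Ht as [s1 Hs1].
  fold (output (bcode t) s1) in Hs1.
  assert (Hhalt : forall a w0, test w0 (bcode a) = 0 -> exists w,
            test w (bcode a) = 0 /\ run M a (result w)).
  { intros a w0 Hw0. destruct (least_zero (fun w => test w (bcode a))) as (w & Hw & Hmin); [now exists w0|].
    exists w. split; auto. apply HM. exists w. auto. }
  pose (s0 := S (bcode t + s1)).
  assert (Hs0 : output (bcode t) s0 = S (zcode k)) by (apply output_mono with s1; auto; unfold s0; lia).
  destruct (Hhalt (tag 0 t) _ (test_base s0 t ltac:(unfold s0; lia) ltac:(lia))) as (w & Hw & Hrun).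
  unfold result in Hrun. apply test_inv in Hw as [(Ew & Hst & Ow & t' & Et & Ht')|(_ & _ & _ & Ht')].
  2: { apply tag_inj in Ht' as [? _]. discriminate. }
  apply tag_inj in Ht' as [_ <-]. rewrite Ew, <- Et in Hrun. rewrite <- Et in Ow, Hst. clear Et Ew.
  change (0 =? 0) with true in Hrun. cbv iota in Hrun.
  set (s := p1 (p2 w)) in *.
  destruct (output (bcode t) s) as [|y] eqn:Hy; [lia|].
  pose proof (output_unique _ _ _ _ _ Hy Hs0) as ->. cbn [pred] in Hrun.
  rewrite zlen_zcode in Hrun.
  (* The search determines the stage [s] used on [tag 0 t]. Either the approximation is final there,
     or the codeword issued at the last later change takes over. *)
  destruct (last_change s k) as [H|(u & Hsu & Hu & Huk & H)].
  - rewrite approx_code_limit in Hrun by auto. exists (tag 0 t). split; auto.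
    rewrite length_tag. lia.
  - assert (Hou : output (bcode t) u = S (zcode k)) by (apply output_mono with s; auto).
    (* Convergence persists up to [u], and [p1 u < k <= zcode k] puts [t] among the descriptions
       served at [u]. *)
    assert (Hd : described u (bcode t) = true).
    { unfold described. apply andb_true_iff. rewrite !Nat.ltb_lt, Hou.
      pose proof (zcode_ge k). lia. }
    clear Hrun. destruct (Hhalt _ _ (test_codeword u (bcode t) Hu Hd)) as (w' & Hw & Hrun).
    apply test_inv in Hw as [(_ & _ & _ & t' & _ & Ht')|(Ew & Aw & Dw & Hw)].
    { apply tag_inj in Ht' as [? _]. discriminate. }
    destruct (codeword_prefix u (bcode t) (p1 (p2 w')) (p2 (p2 w'))) as [E1 E2]; auto.
    { rewrite Hw. apply is_prefix_refl. }
    unfold result in Hrun. rewrite <- E1, <- E2, Hou in Hrun. cbn [pred] in Hrun.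
    rewrite zlen_zcode in Hrun. destruct (Nat.eqb_spec (p1 w') 0); [easy|].
    rewrite approx_code_limit in Hrun by auto.
    exists (codeword u (bcode t)). split; auto.
    unfold codeword. rewrite length_tag, length_bits, blen_bcode.
    destruct (vsum_bound u (bcode t) Hu Hd) as [Hb _]. rewrite blen_bcode in Hb. lia.
Qed.

End Construction.

(** * An effective Cantor scheme *)

Lemma rec2_mu P : rec3 P -> (forall x y, exists n, P n x y = 0) ->
  exists h, rec2 h /\ forall x y, P (h x y) x y = 0.
Proof.
  intros [e He] HP.
  assert (Hf : forall n x y, eval e [n; x; y] (P n x y)).
  { intros n x y. exact (He (scons n (scons x (fun _ => y)))). }
  pose (h := fun x y =>
    proj1_sig (constructive_indefinite_description _ (least_zero (fun n => P n x y) (HP x y)))).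
  assert (Hh : forall x y, P (h x y) x y = 0 /\ forall m, m < h x y -> P m x y <> 0).
  { intros x y. unfold h. destruct constructive_indefinite_description as [n Hn]. exact Hn. }
  exists h. split; [|intros; apply Hh].
  exists (RMu e). intro r. destruct (Hh (r 0) (r 1)) as [H0 Hm]. constructor.
  - pose proof (Hf (h (r 0) (r 1)) (r 0) (r 1)) as E. rewrite H0 in E. exact E.
  - intros m Hmw. exists (pred (P m (r 0) (r 1))).
    replace (S (pred (P m (r 0) (r 1)))) with (P m (r 0) (r 1)) by (specialize (Hm m Hmw); lia).
    apply (Hf m (r 0) (r 1)).
Qed.

Open Scope R_scope.

Lemma half_pow_pos n : 0 < (/ 2) ^ n.
Proof. apply pow_lt. lra. Qed.

Lemma half_pow_le m n : (m <= n)%nat -> (/ 2) ^ n <= (/ 2) ^ m.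
Proof.
  induction 1 as [|n _ IH]; [lra|]. simpl. pose proof (half_pow_pos n). lra.
Qed.

Lemma half_pow_lt eps : 0 < eps -> exists n, (/ 2) ^ n < eps.
Proof.
  intro H. destruct (pow_lt_1_zero (/ 2) ltac:(rewrite Rabs_pos_eq; lra) eps H) as [N HN].
  exists N. specialize (HN N (Nat.le_refl N)).
  pose proof (half_pow_pos N). rewrite Rabs_pos_eq in HN; lra.
Qed.

Lemma names_dist (X : CMS) a (x : X) n : names X a x -> cms_d (cms_q (a n)) x <= (/ 2) ^ n.
Proof.
  intros [Ha Hx]. apply le_epsilon. intros eps Heps.
  destruct (Hx eps Heps) as [N HN].
  specialize (HN (n + N)%nat ltac:(lia)). specialize (Ha n (n + N)%nat ltac:(lia)).
  pose proof (cms_d_tri X (cms_q (a n)) (cms_q (a (n + N)%nat)) x). lra.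
Qed.

Lemma dist_approx (X : CMS) : exists D, rec3 D /\ forall i k n,
  (INR (D i k n) - 1) * (/ 2) ^ n <= cms_d (cms_q (c:=X) i) (cms_q k)
    <= (INR (D i k n) + 1) * (/ 2) ^ n.
Proof.
  destruct (cms_d_computable X) as [e He].
  pose (D := fun i k n => proj1_sig (constructive_indefinite_description _ (He i k n))).
  assert (HD : forall i k n, eval e [i; k; n] (D i k n) /\
    Rabs (INR (D i k n) / 2 ^ n - cms_d (cms_q (c:=X) i) (cms_q k)) <= / 2 ^ n).
  { intros i k n. unfold D. destruct constructive_indefinite_description as [m Hm]. exact Hm. }
  exists D. split.
  - exists e. intro r. apply HD.
  - intros i k n. destruct (HD i k n) as [_ H]. unfold Rdiv in H.
    rewrite <- pow_inv in H. 
    pose proof (Rle_abs (INR (D i k n) * (/ 2) ^ n - cms_d (cms_q (c:=X) i) (cms_q k))).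
    pose proof (Rle_abs (- (INR (D i k n) * (/ 2) ^ n - cms_d (cms_q (c:=X) i) (cms_q k)))) as H'.
    rewrite Rabs_Ropp in H'. lra.
Qed.

Lemma INR_le_bound n m : INR n < INR m + 1 -> (n <= m)%nat.
Proof. intro H. rewrite <- S_INR in H. apply INR_lt in H. lia. Qed.

(** Distances cannot be compared effectively, but approximations can: [2 <= D a b k] certifies the
    lower bound and [D a b (m + 2) <= 1] the upper one. The search for [b] and [k] ends because the
    space is perfect. *)
Lemma branch_exists (X : CMS) : perfect X ->
  exists sel, rec2 sel /\ forall a m,
    (/ 2) ^ p2 (sel a m) <= cms_d (cms_q (c:=X) a) (cms_q (p1 (sel a m))) <= (/ 2) ^ S m.
Proof.
  intro Hperf. destruct (dist_approx X) as (D & HD & Dspec).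
  destruct (rec2_mu (fun w a m => ((2 - D a (p1 w) (p2 w)) + (D a (p1 w) (m + 2) - 1))%nat))
    as (sel & Hsel & Hs).
  - rec_auto.
  - intros a m. set (eps := (/ 2) ^ (m + 2)).
    assert (Heps : 0 < eps) by apply half_pow_pos.
    destruct (Hperf (cms_q a) (eps / 2) ltac:(lra)) as (y & Hy & Hay).
    assert (Hpos : 0 < cms_d (cms_q a) y).
    { destruct (cms_d_nonneg X (cms_q a) y) as [|E]; auto.
      symmetry in E. apply cms_d_zero in E. now destruct Hy. }
    (* The first bound keeps [b] within [eps] of [a], the second keeps it distinct from [a]. *)
    destruct (cms_q_dense X y (Rmin (eps / 2) (cms_d (cms_q a) y))) as [b Hb].
    { apply Rmin_pos; lra. }
    pose proof (Rmin_l (eps / 2) (cms_d (cms_q a) y)).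
    pose proof (Rmin_r (eps / 2) (cms_d (cms_q a) y)).
    pose proof (cms_d_tri X (cms_q a) y (cms_q b)).
    pose proof (cms_d_tri X (cms_q a) (cms_q b) y).
    rewrite (cms_d_sym X (cms_q b) y) in *.
    destruct (half_pow_lt (cms_d (cms_q (c:=X) a) (cms_q b) / 3)) as [k Hk]; [lra|].
    exists (cpair b k). rewrite p1_cpair, p2_cpair.
    assert (Dk : (2 <= D a b k)%nat).
    { apply INR_le_bound. destruct (Dspec a b k) as [_ H3]. simpl INR.
      pose proof (half_pow_pos k). nra. }
    assert (Dm : (D a b (m + 2) <= 1)%nat).
    { apply INR_le_bound. destruct (Dspec a b (m + 2)%nat) as [H3 _]. fold eps in H3.
      simpl INR. nra. }
    lia.
  - exists sel. split; auto. intros a m. specialize (Hs a m). cbv beta in Hs.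
    set (b := p1 (sel a m)) in *. set (k := p2 (sel a m)) in *.
    assert (H1 : (2 <= D a b k)%nat) by lia.
    assert (H2 : (D a b (m + 2) <= 1)%nat) by lia.
    apply le_INR in H1, H2. simpl in H1, H2.
    destruct (Dspec a b k) as [H3 _]. destruct (Dspec a b (m + 2)%nat) as [_ H4].
    pose proof (half_pow_pos k).
    replace (m + 2)%nat with (S (S m)) in * by lia. cbn [pow] in *.
    pose proof (half_pow_pos m). split; nra.
Qed.

Section CantorScheme.

Variable X : CMS.
Variable sel : nat -> nat -> nat.
Hypothesis Hsel : rec2 sel.
Hypothesis sel_spec : forall a m,
  (/ 2) ^ p2 (sel a m) <= cms_d (cms_q (c:=X) a) (cms_q (p1 (sel a m))) <= (/ 2) ^ S m.
Variables p m0 : nat.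

(* A node [z] is a special point [p1 z] with a radius [2 ^ - p2 z]; its two
   children are centred at [p1 z] and at the special point selected near it,
   with a radius that is small with respect to the distance of these centres. *)
Definition child (z c : nat) : nat :=
  cpair (if (c =? 0)%nat then p1 z else p1 (sel (p1 z) (p2 z)))
        (p2 z + p2 (sel (p1 z) (p2 z)) + 4).

Definition node (f : nat -> bool) (n : nat) : nat :=
  nat_rect (fun _ => nat) (cpair p m0) (fun i z => child z (Nat.b2n (f i))) n.

Definition branch (f : nat -> bool) (n : nat) : nat := p1 (node f n).

Lemma rec2_child : rec2 child.
Proof. unfold child. rec_auto. Qed.
#[local] Hint Resolve rec2_child : recdb.

Lemma branch_local f g k : (forall m, (m < k)%nat -> f m = g m) -> branch f k = branch g k.
Proof.
  intro H. unfold branch. f_equal.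
  induction k as [|k IH]; [reflexivity|]. cbn [node nat_rect].
  rewrite (H k) by lia. f_equal. apply IH. intros m Hm. apply H. lia.
Qed.

Lemma branch_rec (A : nat -> nat -> bool) :
  rec2 (fun s n => Nat.b2n (A s n)) -> rec2 (fun s k => branch (A s) k).
Proof.
  intro HA. unfold branch, node. rec_auto.
  apply (recfun_app2 (fun s n => Nat.b2n (A s n))); auto; rec_auto.
Qed.

Lemma node_S f n : node f (S n) = child (node f n) (Nat.b2n (f n)).
Proof. reflexivity. Qed.

Lemma branch_S_false f n : f n = false -> branch f (S n) = branch f n.
Proof. intro H. unfold branch. rewrite node_S, H. unfold child. now rewrite p1_cpair. Qed.

Lemma branch_S_true f n : f n = true ->
  branch f (S n) = p1 (sel (branch f n) (p2 (node f n))).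
Proof. intro H. unfold branch. rewrite node_S, H. unfold child. now rewrite p1_cpair. Qed.

Lemma radius_S f n : p2 (node f (S n)) =
  (p2 (node f n) + p2 (sel (branch f n) (p2 (node f n))) + 4)%nat.
Proof. rewrite node_S. unfold child. now rewrite p2_cpair. Qed.

Lemma radius_ge f n : (n <= p2 (node f n))%nat.
Proof. induction n as [|n IH]; [lia|]. rewrite radius_S. lia. Qed.

Lemma dist_self (x : X) : cms_d x x = 0.
Proof. now apply cms_d_zero. Qed.

(** The difference of radii makes the induction telescope: a move is at most half the current
    radius, and radii at least halve. *)
Lemma branch_dist f n t : (n <= t)%nat ->
  cms_d (cms_q (c:=X) (branch f n)) (cms_q (branch f t))
    <= (/ 2) ^ p2 (node f n) - (/ 2) ^ p2 (node f t).
Proof.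
  induction 1 as [|t Hnt IH].
  - rewrite dist_self. lra.
  - pose proof (cms_d_tri X (cms_q (branch f n)) (cms_q (branch f t)) (cms_q (branch f (S t)))).
    assert (Hst : cms_d (cms_q (c:=X) (branch f t)) (cms_q (branch f (S t)))
                    <= (/ 2) ^ S (p2 (node f t))).
    { destruct (f t) eqn:E.
      - rewrite branch_S_true by auto. apply sel_spec.
      - rewrite branch_S_false, dist_self by auto. apply Rlt_le, half_pow_pos. }
    pose proof (half_pow_le (S (p2 (node f t))) (p2 (node f (S t)))
      ltac:(rewrite radius_S; lia)). cbn [pow] in *. lra.
Qed.

Lemma branch_limit f : exists x, names X (branch f) x /\
  forall n, cms_d (cms_q (branch f n)) x <= (/ 2) ^ p2 (node f n).
Proof.
  assert (Hd : forall n t, (n <= t)%nat ->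
    cms_d (cms_q (c:=X) (branch f n)) (cms_q (branch f t)) <= (/ 2) ^ p2 (node f n)).
  { intros n t H. pose proof (branch_dist f n t H). pose proof (half_pow_pos (p2 (node f t))). lra. }
  assert (Hc : cauchy_name X (branch f)).
  { intros s t H. pose proof (Hd s t H).
    pose proof (half_pow_le s (p2 (node f s)) (radius_ge f s)). lra. }
  destruct (cms_complete X (fun n => cms_q (branch f n))) as [x Hx].
  - intros eps Heps. destruct (half_pow_lt eps Heps) as [N HN]. exists N. intros m n Hm Hn.
    destruct (Nat.le_ge_cases m n) as [H|H].
    + pose proof (Hc m n H). pose proof (half_pow_le N m Hm). lra.
    + rewrite cms_d_sym. pose proof (Hc n m H). pose proof (half_pow_le N n Hn). lra.
  - exists x. split; [now split|]. intro n. apply le_epsilon. intros eps Heps.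
    destruct (Hx eps Heps) as [N HN]. specialize (HN (n + N)%nat ltac:(lia)).
    specialize (Hd n (n + N)%nat ltac:(lia)). cbv beta in HN.
    pose proof (cms_d_tri X (cms_q (branch f n)) (cms_q (branch f (n + N)%nat)) x). lra.
Qed.

(* A name of [x] tells the two children of a node apart, so that the bits of
   [f] can be read off successively. *)
Lemma branch_decode f x :
  (forall n, cms_d (cms_q (branch f n)) x <= (/ 2) ^ p2 (node f n)) ->
  computable_point X x -> rec1 (fun n => Nat.b2n (f n)).
Proof.
  intros Hx (a & Ha & e & He).
  assert (Hrec : rec1 a) by (exists e; intro r; apply He).
  destruct (dist_approx X) as (D & HD & Dspec).
  (* Both children have this radius, so it is known before the bit is. *)
  pose (r z := p2 (child z 0)).
  pose (bit z := Nat.b2n (8 <? D (p1 z) (a (r z)) (r z))%nat).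
  assert (Hbit : forall n, bit (node f n) = Nat.b2n (f n)).
  { intro n.
    assert (Er : r (node f n) = p2 (node f (S n))).
    { rewrite radius_S. unfold r, child. now rewrite p2_cpair. }
    unfold bit. rewrite Er. fold (branch f n).
    set (m := p2 (node f (S n))).
    pose proof (names_dist X a x m Ha) as H1. specialize (Hx (S n)). fold m in Hx.
    destruct (Dspec (branch f n) (a m) m) as [D1 D2].
    pose proof (half_pow_pos m) as Hpos.
    (* The summand 4 in [child] yields this 16. In units of [(/ 2) ^ m], the distance from
       [branch f n] to [a m] is at most 2 for bit 0 and at least 14 for bit 1. With an error of 1,
       [D] is at most 3 or at least 13, and 8 separates the cases. *)
    assert (Hsep : 16 * (/ 2) ^ m <= (/ 2) ^ p2 (sel (branch f n) (p2 (node f n)))).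
    { set (k := p2 (sel (branch f n) (p2 (node f n)))).
      pose proof (half_pow_le (k + 4) m ltac:(unfold m; rewrite radius_S; fold k; lia)) as H.
      rewrite pow_add in H. pose proof (half_pow_pos k). lra. }
    rewrite cms_d_sym in H1.
    destruct (f n) eqn:Ef.
    - rewrite branch_S_true in Hx by auto.
      destruct (sel_spec (branch f n) (p2 (node f n))) as [S1 _].
      set (b := p1 (sel (branch f n) (p2 (node f n)))) in *.
      pose proof (cms_d_tri X (cms_q (branch f n)) (cms_q (a m)) (cms_q b)) as T1.
      pose proof (cms_d_tri X (cms_q (a m)) x (cms_q b)) as T2.
      rewrite (cms_d_sym X x (cms_q b)), (cms_d_sym X (cms_q (a m)) x) in T2.
      destruct (Nat.ltb_spec 8 (D (branch f n) (a m) m)) as [|H]; [reflexivity|].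
      apply le_INR in H. simpl in H. nra.
    - rewrite branch_S_false in Hx by auto.
      pose proof (cms_d_tri X (cms_q (branch f n)) x (cms_q (a m))) as T1.
      destruct (Nat.ltb_spec 8 (D (branch f n) (a m) m)) as [H|]; [|reflexivity].
      apply le_INR in H. simpl in H. nra. }
  assert (Hnode : forall n,
    nat_rect (fun _ => nat) (cpair p m0) (fun _ z => child z (bit z)) n = node f n).
  { induction n as [|n IH]; [reflexivity|]. cbn [nat_rect]. now rewrite IH, Hbit. }
  apply (recfun_ext _ (fun r => bit
    (nat_rect (fun _ => nat) (cpair p m0) (fun _ z => child z (bit z)) (r 0%nat)))).
  - intro r'. now rewrite Hnode, Hbit.
  - assert (rec1 bit) by (unfold bit, r; rec_auto). rec_auto.
Qed.

End CantorScheme.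

Theorem mainTheorem16 (U : rf) (HU : optimal_pf U) (X : CMS) (Hperf : perfect X)
  (p : nat) (delta : Q) (Hdelta : (0 < delta)%Q) :
  exists x : X,
    ~ computable_point X x /\ K_trivial_point X U x /\
    cms_d (cms_q (c:=X) p) x < Q2R delta.
Proof.
  destruct (branch_exists X Hperf) as (sel & Hsel & sel_spec).
  assert (Hd : 0 < Q2R delta).
  { apply Qlt_Rlt in Hdelta. unfold Q2R at 1 in Hdelta. simpl in Hdelta. lra. }
  destruct (half_pow_lt _ Hd) as [m0 Hm0].
  destruct (branch_limit X sel sel_spec p m0 (limit_set U)) as (x & Hname & Hx).
  exists x. repeat split.
  - intro Hc. apply (limit_set_not_rec U HU). eapply branch_decode; eauto.
  - exists (branch sel p m0 (limit_set U)). split; auto.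
    apply K_trivial_limit; auto.
    + intros. now apply branch_local.
    + intros. now apply branch_rec.
  - specialize (Hx 0%nat). unfold branch, node in Hx. simpl in Hx.
    rewrite p1_cpair, p2_cpair in Hx. lra.
Qed.
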